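(* Let $B$ be a finite connected CW left regular band and $\Bbbk$ a field. Then the Cartan matrix of $\Bbbk B$ is given by $C_{X,Y}=|\mu(Y,X)|$ if $X\ge Y$ and $C_{X,Y}=0$ otherwise, where $\mu$ is the Möbius function of $\Lambda(B)$.
   Context: A left regular band is a finite semigroup $B$ with $x^2=x$, $xyx=xy$, ordered by $a\le b$ iff $ba=a$; $\Lambda(B)=\{Bb\}$ ordered by inclusion; $B_{\ge X}=\{b\mid Bb\supseteq X\}$; $B$ is connected if each order complex $\Delta(B_{\ge X})$ is connected. A CW poset is a finite graded poset $P$ such that the realization of $\Delta(P_{<p})$ is a sphere of dimension $\dim\Delta(P_{\le p})-1$; $B$ is a CW left regular band if every $B_{\ge X}$ is a CW poset. For $X\in\Lambda(B)$, $\Bbbk_X$ is $\Bbbk$ with $b$ acting by $1$ if $Bb\supseteq X$, else $0$ (the simple modules), and $\Bbbk L_X$, with $L_X=\{b\mid Bb=X\}$ and $a\cdot b=ab$ if $Ba\supseteq X$ and $0$ otherwise, is the projective cover of $\Bbbk_X$. $C_{X,Y}$ is the multiplicity of $\Bbbk_X$ as a composition factor of $\Bbbk L_Y$. *)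

(* Defs.v *)
From HB Require Import structures.
From mathcomp Require Import all_boot all_order all_algebra.
From mathcomp Require Import boolp classical_sets reals topology normedtype.
Set Implicit Arguments.
Unset Strict Implicit.
Unset Printing Implicit Defensive.
Import Order.TTheory GRing.Theory Num.Theory.
Import numFieldNormedType.Exports.
Local Open Scope set_scope.
Local Open Scope ring_scope.

Section Posets.
Context {d : Order.disp_t} {P : finPOrderType d}.
Implicit Types (A s t : {set P}) (p x y z : P).

Fixpoint mobius_rec (n : nat) x y : int :=
  if n is n'.+1 then
    if x == y then 1
    else if (x < y)%O then - \sum_(z | (x <= z < y)%O) mobius_rec n' x z
    else 0
  else 0.

(* The fuel #|P| suffices: see mobiusE. *)
Definition mobius x y : int := mobius_rec #|P| x y.

Lemma mobius_rec_fuel m n x y :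
  (#|[set z | (z < y)%O]| < m)%N -> (#|[set z | (z < y)%O]| < n)%N ->
  mobius_rec m x y = mobius_rec n x y.
Proof.
elim: m n y => [|m IHm] [|n] y //; rewrite !ltnS => ym yn /=.
case: eqP => // _; case: ifP => // _; congr (- _).
apply: eq_bigr => z /andP[_ ltzy].
have lt_card : (#|[set w | (w < z)%O]| < #|[set w | (w < y)%O]|)%N.
  apply: proper_card; apply/properP; split.
    by apply/fintype.subsetP => w; rewrite !inE => /lt_trans; apply.
  by exists z; rewrite !inE ?ltxx.
by apply: IHm; [exact: leq_trans lt_card ym | exact: leq_trans lt_card yn].
Qed.

Lemma mobiusE x y :
  mobius x y = if x == y then 1
               else if (x < y)%O then - \sum_(z | (x <= z < y)%O) mobius x z
               else 0.
Proof.
have fuelP z : (#|[set w | (w < z)%O]| < #|P|)%N.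
  rewrite -cardsT; apply: proper_card; rewrite properT; apply/eqP => /setP/(_ z).
  by rewrite !inE ltxx.
rewrite /mobius (@mobius_rec_fuel _ #|P|.+1) //=; last by rewrite ltnS ltnW.
Qed.

Definition chain s : bool := [forall x in s, forall y in s, (x >=< y)%O].

(* As usual the empty face is included. *)
Definition order_complex A : {set {set P}} :=
  [set s : {set P} | (s \subset A) && chain s].

(* Truncated at 0: correct for complexes with at least one vertex, the only ones
   it is applied to below. *)
Definition complex_dim (K : {set {set P}}) : nat :=
  (\max_(s in K) #|s|).-1.

(* Barycentric coordinates, with the topology induced by the finite
   power R^P. *)
Definition realization (R : realType) (K : {set {set P}}) :
    set {ptws P -> R} :=
  [set x : {ptws P -> R} | [/\ (forall p, 0 <= x p), \sum_p x p = 1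
                             & [set p | x p != 0]%SET \in K]]%classic.

Definition down_le A p : {set P} := [set q in A | (q <= p)%O].
Definition down_lt A p : {set P} := [set q in A | (q < p)%O].

(* Lower intervals are pure; P itself need not be (the face poset of a regular
   CW complex whose maximal cells have different dimensions is graded). *)
Definition graded A : Prop :=
  forall p, p \in A -> forall s t,
    maxset (mem (order_complex (down_le A p))) s ->
    maxset (mem (order_complex (down_le A p))) t -> #|s| = #|t|.

End Posets.
Arguments realization {d P} R K.

(* The unit sphere of R^n has dimension n - 1; it is empty for n = 0. *)
Definition unit_sphere (R : realType) (n : nat) : set 'rV[R]_n :=
  [set x : 'rV[R]_n | \sum_(i < n) x ord0 i ^+ 2 = 1]%classic.
Arguments unit_sphere : clear implicits.

Definition homeomorphic (S T : topologicalType) : Prop :=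
  exists (f : S -> T) (g : T -> S),
    [/\ continuous f, continuous g, cancel f g & cancel g f].

(* The poset is A with the order induced from P. *)
Definition cw_poset (R : realType) (d : Order.disp_t) (P : finPOrderType d)
    (A : {set P}) : Prop :=
  graded A /\
  forall p, p \in A ->
    homeomorphic
      (set_type (realization R (order_complex (down_lt A p))))
      (set_type (unit_sphere R (complex_dim (order_complex (down_le A p))))).

Local Open Scope group_scope.

HB.mixin Record isLeftRegularBand B of Semigroup B & Finite B := {
  lrb_mulxx : forall x : B, x * x = x;
  lrb_mulxyx : forall x y : B, x * y * x = x * y
}.

#[short(type="lrbType")]
HB.structure Definition LRB :=
  { B of Semigroup B & Finite B & isLeftRegularBand B }.

Fact lrb_display : Order.disp_t. Proof. exact: Order.Disp tt tt. Qed.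

Section LRBOrder.
Variable B : lrbType.
Implicit Types a b c x : B.

Definition lrb_le a b : bool := b * a == a.

Fact lrb_le_refl : reflexive lrb_le.
Proof. by move=> a; rewrite /lrb_le lrb_mulxx. Qed.

Fact lrb_le_anti : antisymmetric lrb_le.
Proof.
move=> a b /andP[/eqP ba /eqP ab].
by rewrite -[LHS]ba -[X in X * a = _]ab lrb_mulxyx.
Qed.

Fact lrb_le_trans : transitive lrb_le.
Proof.
by move=> b a c /eqP ba /eqP cb; rewrite /lrb_le -ba mulgA cb.
Qed.

End LRBOrder.

HB.instance Definition _ (B : lrbType) :=
  Order.Le_isPOrder.Build lrb_display (LRB.sort B)
    (@lrb_le_refl B) (@lrb_le_anti B) (@lrb_le_trans B).

Section Supports.
Variable B : lrbType.
Implicit Types a b c : B.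

Definition lideal b : {set B} := [set x * b | x : B].

Lemma in_lideal a b : (a \in lideal b) = (a * b == a).
Proof.
apply/imsetP/eqP => [[x _ ->]|ab]; last by exists a.
by rewrite -mulgA lrb_mulxx.
Qed.

Lemma lideal_sub a b : (lideal a \subset lideal b) = (a * b == a).
Proof.
apply/fintype.subsetP/eqP => [/(_ a)|ab x].
  by rewrite !in_lideal lrb_mulxx eqxx => /(_ isT) /eqP.
by rewrite !in_lideal => /eqP xa; rewrite -{1}xa -mulgA ab xa.
Qed.

Lemma lideal_mul a b : lideal (a * b) = lideal a :&: lideal b.
Proof.
apply/finset.setP => x; rewrite inE !in_lideal.
apply/eqP/andP => [xab|[/eqP xa /eqP xb]]; last by rewrite mulgA xa xb.
split; last by rewrite -{1}xab -!mulgA lrb_mulxx xab.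
by rewrite -{1}xab -mulgA lrb_mulxyx xab.
Qed.

(* Lambda(B), the poset of principal left ideals under inclusion. *)
Definition Lambda : Type := {X : {set B} | X \in [set lideal b | b : B]}.
HB.instance Definition _ := SubFinite.on Lambda.

Definition Lambda_le (X Y : Lambda) : bool := val X \subset val Y.

Fact Lambda_le_refl : reflexive Lambda_le.
Proof. by move=> X; apply: subxx. Qed.

Fact Lambda_le_anti : antisymmetric Lambda_le.
Proof. by move=> X Y XY; apply/val_inj/eqP; rewrite finset.eqEsubset. Qed.

Fact Lambda_le_trans : transitive Lambda_le.
Proof. by move=> Y X Z; apply: fintype.subset_trans. Qed.

HB.instance Definition _ := Order.Le_isPOrder.Build lrb_display Lambda
  Lambda_le_refl Lambda_le_anti Lambda_le_trans.

Implicit Types X Y : Lambda.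

(* b acts nontrivially on the modules attached to X. *)
Definition supports b X : bool := val X \subset lideal b.

Lemma supports_mul a b X : supports (a * b) X = supports a X && supports b X.
Proof. by rewrite /supports lideal_mul finset.subsetI. Qed.

Definition B_ge X : {set B} := [set b | supports b X].

Definition L X : {set B} := [set b | lideal b == val X].

Definition connected_lrb (R : realType) : Prop :=
  forall X, connected (realization R (order_complex (B_ge X))).

Definition cw_lrb (R : realType) : Prop := forall X, cw_poset R (B_ge X).

End Supports.

Section Modules.
Variables (k : fieldType) (B : lrbType).
Implicit Types (a b c : B) (X Y : Lambda B).
Local Open Scope ring_scope.

(* The semigroup algebra kB: the function f stands for \sum_b f b *: b.
   It has no unit in general. *)
Definition sgalg : Type := {ffun B -> k^o}.
HB.instance Definition _ := Vector.on sgalg.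

Definition sgalg_mul (f g : sgalg) : sgalg :=
  [ffun c => \sum_(ab : B * B | (ab.1 * ab.2)%g == c) f ab.1 * g ab.2].

Record sgmodule := SgModule {
  sgmodule_sort :> vectType k;
  sgact : {linear sgalg -> 'End(sgmodule_sort)};
  sgactM : forall f g, sgact (sgalg_mul f g) = (sgact f \o sgact g)%VF
}.

Section LinearExtension.
Variables (V : vectType k) (act : B -> 'End(V)).
Hypothesis actM : forall a b, act (a * b)%g = (act a \o act b)%VF.

Definition linext (f : sgalg) : 'End(V) := \sum_b f b *: act b.

Fact linext_linear : linear linext.
Proof.
move=> c f g; rewrite /linext scaler_sumr -big_split /=.
by apply: eq_bigr => b _; rewrite !ffunE scalerDl scalerA.
Qed.

HB.instance Definition _ :=
  GRing.isLinear.Build k sgalg 'End(V) _ linext linext_linear.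

Fact linextM f g : linext (sgalg_mul f g) = (linext f \o linext g)%VF.
Proof.
apply/lfunP => v; rewrite comp_lfunE [linext g v]sum_lfunE linear_sum [LHS]sum_lfunE.
have -> : \sum_a linext f ((g a *: act a) v)
          = \sum_a \sum_b (f b * g a) *: act (b * a)%g v.
  apply: eq_bigr => a _; rewrite sum_lfunE; apply: eq_bigr => b _.
  by rewrite !scale_lfunE linearZ /= scalerA actM comp_lfunE.
under eq_bigr do rewrite scale_lfunE ffunE scaler_suml.
rewrite (exchange_big_dep xpredT) //= exchange_big pair_bigA /=.
apply: eq_bigr => -[a b] _ /=.
by rewrite (big_pred1 (a * b)%g) // => c; rewrite eq_sym.
Qed.

Definition linext_module : sgmodule := SgModule linextM.

End LinearExtension.

(* The one-dimensional module k_X. *)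
Definition simple_act X b : 'End(k^o) := if supports b X then \1%VF else 0.

Fact simple_actM X a b :
  simple_act X (a * b)%g = (simple_act X a \o simple_act X b)%VF.
Proof.
rewrite /simple_act supports_mul.
by case: (supports a X); case: (supports b X);
  rewrite ?comp_lfun1l ?comp_lfun0l ?comp_lfun0r.
Qed.

Definition simple_module X : sgmodule := linext_module (simple_actM X).

(* kL_X: the vector v stands for \sum_l v l *: l, so that the coefficient of m
   in b v is the sum of the v l with b l = m. *)
Definition kL X : vectType k := {ffun {b | b \in L X} -> k^o}.

Definition kL_fun X b (v : kL X) : kL X :=
  [ffun m => if supports b X
             then \sum_(l | (b * val l)%g == val m) v l else 0].

Fact kL_fun_linear X b : linear (@kL_fun X b).
Proof.
move=> c u v; apply/ffunP => m; rewrite !ffunE.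
case: ifP => _; last by rewrite scaler0 addr0.
by rewrite scaler_sumr -big_split; apply: eq_bigr => l _; rewrite !ffunE.
Qed.

HB.instance Definition _ X b :=
  GRing.isLinear.Build k (kL X) (kL X) _ (@kL_fun X b) (@kL_fun_linear X b).

Definition kL_act X b : 'End(kL X) := linfun (@kL_fun X b).

Fact L_mul X b (l : B) : supports b X -> l \in L X -> (b * l)%g \in L X.
Proof.
rewrite !inE /supports lideal_mul => sXb /eqP lX.
by rewrite lX finset.eqEsubset finset.subsetIr finset.subsetI sXb fintype.subxx.
Qed.

Fact kL_actM X a b : kL_act X (a * b)%g = (kL_act X a \o kL_act X b)%VF.
Proof.
apply/lfunP => v; rewrite comp_lfunE !lfunE; apply/ffunP => m.
rewrite !ffunE supports_mul.
case: (boolP (supports a X)) => //= sa.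
case: (boolP (supports b X)) => [sb|/negPf sb]; last first.
  by rewrite big1 // => l _; rewrite ffunE sb.
under [RHS]eq_bigr do rewrite ffunE sb.
rewrite (exchange_big_dep xpredT) //= big_mkcond /=; apply: eq_bigr => l _.
pose bl : {b | b \in L X} := Sub (b * val l)%g (L_mul sb (valP l)).
rewrite -mulgA; case: ifP => abl.
  rewrite (big_pred1 bl) // => c /=; apply/andP/eqP => [[_ /eqP e]|->//].
  exact/val_inj/esym.
rewrite big_pred0 // => c; apply/negP => /andP[/eqP ac /eqP bc].
by rewrite bc ac eqxx in abl.
Qed.

Definition projective_module X : sgmodule := linext_module (@kL_actM X).

Section CompositionFactors.
Variable M : sgmodule.
Implicit Types U V W : {vspace M}.

Definition submodule U : Prop := forall f : sgalg, (sgact M f @: U <= U)%VS.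

(* U / W is simple, by the correspondence between the submodules of U / W and
   those between W and U. *)
Definition simple_quotient U W : Prop :=
  [/\ submodule U, submodule W, (W <= U)%VS, W != U &
      forall V, submodule V -> (W <= V <= U)%VS -> V = W \/ V = U].

(* U / W is isomorphic to S: there is an equivariant map of U onto S with
   kernel W (given as the restriction to U of a linear map on M). *)
Definition quotient_iso U W (S : sgmodule) : Prop :=
  exists h : 'Hom(M, S),
    [/\ (h @: U)%VS = fullv, (U :&: lker h)%VS = W &
        forall f u, u \in U -> h (sgact M f u) = sgact S f (h u)].

(* 0 = F 0 < F 1 < ... < F n = M, with simple successive quotients. *)
Definition composition_series (n : nat) (F : nat -> {vspace M}) : Prop :=
  [/\ F 0%N = 0%VS, F n = fullv &
      forall i, (i < n)%N -> simple_quotient (F i.+1) (F i)].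

Definition factor_count (n : nat) (F : nat -> {vspace M}) (S : sgmodule) :
    nat :=
  \sum_(i < n) `[< quotient_iso (F i.+1) (F i) S >].

(* S has multiplicity m in M; by Jordan-Hoelder there is exactly one such m. *)
Definition multiplicity (S : sgmodule) (m : nat) : Prop :=
  (exists n F, composition_series n F) /\
  (forall n F, composition_series n F -> factor_count n F S = m).

End CompositionFactors.

Definition cartan_matrix (C : Lambda B -> Lambda B -> nat) : Prop :=
  forall X Y, multiplicity (projective_module Y) (simple_module X) (C X Y).

End Modules.

(* Main.v *)
(* Write n_X for the multiplicity of k_X in kL_Y and f(b) for the number of
   elements of L_Y below b.  On a simple subquotient every b acts as 0 or 1,
   because bab = ba makes the kernel of b a submodule; hence the subquotient is a
   line, and comparing ranks of b gives \sum_(X <= Bb) n_X = f(b).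
   For a cell x of the CW poset B_>=Y the boundary of x is a sphere, so its Euler
   characteristic is that of a sphere; counting chains below x by their largest
   element yields \sum_(b <= x, Bb >= Y) (-1)^(rank_Y b) = 1.  Ranks being
   additive, rank_Y x = rank_Y b + rank_(Bb) x, two Moebius inversions turn these
   relations into n_X = (-1)^r mu(Y, X), and n_X >= 0 forces n_X = |mu(Y, X)|.
   The Euler characteristic of a complex K with |K| homeomorphic to a sphere is
   computed without subdivisions: K is chain homotopy equivalent to the ordered
   Vietoris complex of |K| at every small scale, and the scales of |K| and of the
   cross-polytope are interleaved by uniform continuity.  This makes K and the
   cross-polytope chain homotopy equivalent, and the supertrace of the identity is
   a homotopy invariant. *)

Require Import Defs.
From HB Require Import structures.
From mathcomp Require Import boolp classical_sets functions topology normedtype.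
From mathcomp Require Import all_boot all_order all_algebra reals.
From mathcomp Require Import freeg ring lra zify.
Set Implicit Arguments.
Unset Strict Implicit.
Unset Printing Implicit Defensive.
Import Order.TTheory GRing.Theory Num.Theory.
Import numFieldNormedType.Exports.
Local Open Scope ring_scope.

(** A homeomorphism respects neither simplices nor subdivisions, only nearness of points. Vietoris
    complexes are built from nearness alone: over one compact space, a second system of coordinates
    changes only what counts as close. They are infinite and carry no trace, so supertraces are
    taken only of round trips starting and ending in a finite complex. The two legs of such a trip
    pose different problems. A simplex of K is too large to be a close tuple, so it is sent to a
    chain of small tuples inside its closed face, which exists because that face is acyclic at every
    scale. In the other direction, close points are rounded to vertices with a sizeable coordinate,
    and these always span a face. All complexes are augmented, so that the value (-1)^n covers the
    empty sphere, the boundary of a minimal cell. On the algebraic side the relations for n_X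
    involve one cell for each support; choosing all these cells below a single cell x makes their
    signs comparable. *)

(** Dependent choice along a measure, for chain maps and homotopies built one dimension at a time:
    the filling chosen on a simplex depends on those chosen on its faces. The first hypothesis says
    that [Q s f] sees [f] only below [m s], so a finite stage of the recursion can stand for the
    final function. *)
Lemma size_rec_choice (S T : Type) (m : S -> nat) (t0 : T)
    (Q : S -> (S -> T) -> T -> Prop) :
  (forall s f g y, (forall t, (m t < m s)%N -> f t = g t) ->
     Q s f y -> Q s g y) ->
  (forall s f, (forall t, (m t < m s)%N -> Q t f (f t)) -> exists y, Q s f y) ->
  exists f, forall s, Q s f (f s).
Proof.
move=> Qcongr Qex.
have /choice[step stepP] (sf : S * (S -> T)) : exists y,
    (forall t, (m t < m sf.1)%N -> Q t sf.2 (sf.2 t)) -> Q sf.1 sf.2 y.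
  case: sf => s f /=.
  have [H|H] := EM (forall t, (m t < m s)%N -> Q t f (f t)).
    by have [y Qy] := Qex _ _ H; exists y.
  by exists t0 => /H.
(* The value at [s] is settled at stage [(m s).+1] and copied at every later stage; earlier values
   are irrelevant. *)
pose fix F n (s : S) {struct n} : T := if n is n'.+1 then
  if (m s < n')%N then F n' s else step (s, F n') else t0.
have Fstable n s : (m s < n)%N -> F n s = F (m s).+1 s.
  elim: n => // n IHn; rewrite ltnS leq_eqVlt => /predU1P[->//|lt_sn].
  by rewrite [LHS]/= lt_sn IHn.
pose f s := F (m s).+1 s.
exists f => s; have [n] := ubnP (m s); elim: n s => // n IHn s lesn.
apply: (Qcongr _ (F (m s))); first by move=> t; apply: Fstable.
have -> : f s = step (s, F (m s)) by rewrite /f /= ltnn.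
apply: (stepP (s, F (m s))) => /= t ltts.
rewrite Fstable //; apply: (Qcongr _ f).
  by move=> u ltut; rewrite Fstable // (ltn_trans ltut).
by apply: IHn; apply: leq_trans ltts _.
Qed.

(** * Ordered chains and acyclic carriers *)

Notation chains X := {freeg (seq X) / int}.

Section LinearExtension.
Variables X Y : choiceType.
Implicit Types (f g : seq X -> chains Y) (z : chains X).

Definition ext f z : chains Y := fglift f z.

Fact ext_is_additive f : additive (ext f).
Proof. exact: lift_is_additive. Qed.

HB.instance Definition _ f :=
  GRing.isAdditive.Build (chains X) (chains Y) (ext f) (ext_is_additive f).

Lemma extU f s : ext f << s >> = f s.
Proof. by rewrite /ext liftU scale1r. Qed.

Lemma extE f z : ext f z = \sum_(s <- dom z) coeff s z *: f s.
Proof.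
rewrite -{1}(freeg_sumE z) raddf_sum /=; apply: eq_bigr => s _.
exact: liftU.
Qed.

Lemma extZ f c z : ext f (c *: z) = c *: ext f z.
Proof. by rewrite -[c]intz !scaler_int raddfMz. Qed.

Lemma coeff_ext f z t : coeff t (ext f z) = \sum_(s <- dom z) coeff s z * coeff t (f s).
Proof. by rewrite extE raddf_sum; apply: eq_bigr => s _; rewrite /= coeffZ. Qed.

Lemma extDl f g z : ext (fun s => f s + g s) z = ext f z + ext g z.
Proof. by rewrite !extE -big_split; apply: eq_bigr => s _; rewrite scalerDr. Qed.

Lemma extNl f z : ext (fun s => - f s) z = - ext f z.
Proof. by rewrite !extE -sumrN; apply: eq_bigr => s _; rewrite scalerN. Qed.

Lemma extBl f g z : ext (fun s => f s - g s) z = ext f z - ext g z.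
Proof. by rewrite extDl extNl. Qed.

End LinearExtension.

Lemma ext_id (X : choiceType) (z : chains X) : ext (fun s => << s >>) z = z.
Proof.
rewrite extE -[RHS]freeg_sumE; apply: eq_bigr => s _.
by apply/eqP/freeg_eqP => t; rewrite coeffZ !coeffU mul1r.
Qed.

Lemma ext_ext (X Y Z : choiceType) (f : seq Y -> chains Z)
    (g : seq X -> chains Y) (z : chains X) :
  ext f (ext g z) = ext (fun s => ext f (g s)) z.
Proof.
rewrite [ext g z]extE raddf_sum [RHS]extE; apply: eq_bigr => s _.
exact: extZ.
Qed.

Section Support.
Variable X : choiceType.
Implicit Types (P Q : seq X -> Prop) (z : chains X).

Record supported P z : Prop := Supported {
  supportedP :> forall s, s \in dom z -> P s }.

Lemma supported0 P : supported P 0.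
Proof. by split=> s; rewrite dom0. Qed.

Lemma supportedD P z1 z2 : supported P z1 -> supported P z2 -> supported P (z1 + z2).
Proof.
move=> P1 P2; split=> s /domD_subset; rewrite mem_cat => /orP[].
  exact: P1.
exact: P2.
Qed.

Lemma supportedN P z : supported P z -> supported P (- z).
Proof. by move=> Pz; split=> s; rewrite domN; apply: Pz. Qed.

Lemma supportedB P z1 z2 : supported P z1 -> supported P z2 -> supported P (z1 - z2).
Proof. by move=> P1 P2; apply: supportedD => //; apply: supportedN. Qed.

Lemma supportedZ P c z : supported P z -> supported P (c *: z).
Proof. by move=> Pz; split=> s /domZ_subset; apply: Pz. Qed.

Lemma supportedU P s : P s -> supported P << s >>.
Proof. by move=> Ps; split=> t; rewrite domU1 inE => /eqP ->. Qed.

Lemma supported_sub P Q z : (forall s, P s -> Q s) -> supported P z -> supported Q z.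
Proof. by move=> PQ Pz; split=> s /Pz /PQ. Qed.

End Support.

Lemma supported_ext (X Y : choiceType) (P : seq X -> Prop) (Q : seq Y -> Prop)
    f (z : chains X) :
  supported P z -> (forall s, P s -> supported Q (f s)) -> supported Q (ext f z).
Proof.
move=> Pz Qf; rewrite extE big_seq; elim/big_rec: _ => [|s c sz Qc].
  exact: supported0.
apply: supportedD; last exact: Qc.
apply: supportedZ; apply: Qf; exact: (Pz s sz).
Qed.

Lemma eq_ext (X Y : choiceType) (f g : seq X -> chains Y) P z :
  supported P z -> (forall s, P s -> f s = g s) -> ext f z = ext g z.
Proof.
move=> Pz fg; rewrite !extE !big_seq; apply: eq_bigr => s sz.
by rewrite fg //; apply: Pz.
Qed.

Section Boundary.
Variable X : choiceType.
Implicit Types (s t : seq X) (z : chains X) (A : seq X -> Prop).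

Definition cone (x : X) s : chains X := << x :: s >>.

(* The empty simplex is a face of every vertex: this is the augmented complex. *)
Fixpoint bd s : chains X := if s is x :: s' then << s' >> - ext (cone x) (bd s') else 0.

Lemma bd_cone x z : ext bd (ext (cone x) z) = z - ext (cone x) (ext bd z).
Proof.
rewrite !ext_ext -{2}[z]ext_id -extBl; apply: (eq_ext (P := xpredT)) => // s _.
by rewrite extU.
Qed.

Lemma bd_bd s : ext bd (bd s) = 0.
Proof.
elim: s => [|x s IHs] /=; first by rewrite raddf0.
by rewrite raddfB /= extU bd_cone IHs raddf0 subr0 subrr.
Qed.

Definition face t s := subseq t s /\ (size t).+1 = size s.

Lemma supported_bd s : supported (face^~ s) (bd s).
Proof.
elim: s => [|x s IHs] /=; first exact: supported0.
apply: supportedB; first by apply: supportedU; split=> //; apply: subseq_cons.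
apply: supported_ext IHs _ => t [ts szt]; apply: supportedU; split.
  by rewrite /= eqxx.
by rewrite /= szt.
Qed.

Definition subcomplex A := forall s t, A s -> subseq t s -> A t.

Definition of_size A n s := A s /\ size s = n.

(** The degree [n] counts vertices, one more than the dimension. At [n = 0] the condition makes the
    empty simplex, if present, bound a chain of vertices: it is reduced homology that vanishes. *)
Definition acyclic A := forall n z, supported (of_size A n) z -> ext bd z = 0 ->
  exists2 c, supported (of_size A n.+1) c & ext bd c = z.

Lemma contraction_acyclic A (h : seq X -> chains X) :
  (forall s, A s -> supported (of_size A (size s).+1) (h s)) ->
  (forall s, A s -> ext bd (h s) + ext h (bd s) = << s >>) -> acyclic A.
Proof.
move=> Ah hP n z Az z0; exists (ext h z).
  by apply: supported_ext Az _ => s [As <-]; apply: Ah.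
transitivity (ext bd (ext h z) + ext h (ext bd z)).
  by rewrite z0 raddf0 addr0.
rewrite !ext_ext -extDl -[RHS]ext_id.
by apply: eq_ext Az _ => s [As _]; apply: hP.
Qed.

Lemma full_acyclic (F : {pred X}) x : x \in F -> acyclic (fun s => all (mem F) s).
Proof.
move=> Fx; apply: (contraction_acyclic (h := cone x)) => s Fs.
  by apply: supportedU; split; rewrite //= Fx.
by rewrite /cone extU /= subrK.
Qed.

(** An ordered simplex without repetitions is contracted by coning from its first vertex, which
    keeps the order. A simplex already containing [x] cannot receive it again, so there the
    contraction is zero. *)
Lemma subseq_acyclic x l : uniq (x :: l) -> acyclic (fun s => subseq s (x :: l)).
Proof.
move=> Ul; pose h s : chains X := if x \in s then 0 else cone x s.
have sub_cons s : subseq s (x :: l) -> x \notin s -> subseq (x :: s) (x :: l).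
  case: s => [|y s] /=; first by rewrite eqxx sub0seq.
  by case: (eqVneq y x) => [->|_ sl _]; rewrite ?inE ?eqxx.
apply: (contraction_acyclic (h := h)) => s sl; rewrite /h.
  case: ifP => [_|/negbT xs]; first exact: supported0.
  by apply: supportedU; split; first exact: sub_cons.
case: ifP => [|/negbT xs]; last first.
  rewrite /cone extU /=.
  suff -> : ext h (bd s) = ext (cone x) (bd s) by rewrite subrK.
  apply: eq_ext (@supported_bd s) _ => t [ts _]; rewrite /h ifN //.
  by apply: contraNN xs; apply: mem_subseq.
have Us := subseq_uniq sl Ul.
case: s sl Us => // y s /=; case: (eqVneq y x) => [->|yx] sl /andP[ys Us]; last first.
  rewrite inE => /predU1P[xy|xs]; first by rewrite xy eqxx in yx.
  by case/andP: Ul => /negP[]; apply: (mem_subseq sl); rewrite inE xs orbT.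
(* The simplex starts with [x]: deleting [x] and coning back restores it, while all its other faces
   contain [x] and are killed by [h]. *)
move=> _; rewrite raddf0 add0r raddfB /= extU (negPf ys).
rewrite ext_ext [X in _ - X](_ : _ = 0) ?subr0 // extE big1 // => t _.
by rewrite /cone extU inE eqxx scaler0.
Qed.

End Boundary.
Arguments bd {X} s.

Section ChainMaps.
Variables X Y : choiceType.
Implicit Types (K : seq X -> Prop) (L : seq Y -> Prop) (f g : seq X -> chains Y).

Definition chain_map K L f :=
  (forall s, K s -> supported (of_size L (size s)) (f s)) /\
  (forall s, K s -> ext bd (f s) = ext f (bd s)).

Definition homotopic K L f g := exists h : seq X -> chains Y,
  (forall s, K s -> supported (of_size L (size s).+1) (h s)) /\
  (forall s, K s -> f s - g s = ext bd (h s) + ext h (bd s)).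

Definition carries K (Phi : seq X -> seq Y -> Prop) f :=
  forall s, K s -> supported (of_size (Phi s) (size s)) (f s).

(* On the empty simplex no acyclicity is required: there the chain maps are
   prescribed. *)
Definition acyclic_carrier K (Phi : seq X -> seq Y -> Prop) :=
  (forall s, K s -> (0 < size s)%N -> acyclic (Phi s)) /\
  (forall s t, K s -> subseq t s -> forall u, Phi t u -> Phi s u).

Lemma chain_map_carries K L Phi f : (forall s u, K s -> Phi s u -> L u) ->
  carries K Phi f -> (forall s, K s -> ext bd (f s) = ext f (bd s)) -> chain_map K L f.
Proof.
move=> PhiL cf bf; split=> // s Ks.
by apply: supported_sub (cf _ Ks) => u [Pu szu]; split=> //; apply: PhiL Pu.
Qed.

(** Existence half of the acyclic carrier theorem. Once [f] is chosen on the faces of [s], the chain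
    [ext f (bd s)] is a cycle, and it lies in [Phi s] by monotonicity; [f s] is any chain of [Phi s]
    that it bounds. *)
Lemma carrier_chain_map K Phi : subcomplex K -> acyclic_carrier K Phi ->
    Phi [::] [::] ->
  exists f, [/\ f [::] = << [::] >>, carries K Phi f &
    forall s, K s -> ext bd (f s) = ext f (bd s)].
Proof.
move=> subK [acPhi monoPhi] Phi0.
pose Q s (f : seq X -> chains Y) y := (s = [::] -> y = << [::] >>) /\
  (K s -> supported (of_size (Phi s) (size s)) y /\ ext bd y = ext f (bd s)).
have [|s f IH|f fQ] := @size_rec_choice _ _ size 0 Q.
- move=> s f g y fg [Q0 Q1]; split=> // Ks; have [Q2 ->] := Q1 Ks; split=> //.
  by apply: eq_ext (@supported_bd _ s) _ => t [_ szt]; apply: fg; rewrite -szt.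
- have [Ks|nKs] := EM (K s); last first.
    case: s {IH} nKs => [|x s] nKs; first by exists << [::] >>; split.
    by exists 0; split.
  have [s0|s_gt0] := posnP (size s).
    rewrite (size0nil s0); exists << [::] >>; split=> // _; split.
      by apply: supportedU; split.
    by rewrite extU raddf0.
  have fface t : face t s -> supported (of_size (Phi t) (size t)) (f t) /\
      ext bd (f t) = ext f (bd t).
    move=> [ts szt]; have Kt : K t by apply: subK ts.
    by have [|_] := IH t; rewrite -?szt // => /(_ Kt).
  have [|| c cP bc] := acPhi s Ks s_gt0 (size s).-1 (ext f (bd s)).
  + apply: supported_ext (@supported_bd _ s) _ => t ft.
    have [ct _] := fface t ft; have [ts szt] := ft.
    apply: supported_sub ct => u [Pu szu]; split; last by rewrite szu -szt.
    exact: (monoPhi _ _ Ks ts _ Pu).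
  + transitivity (ext f (ext bd (bd s))); last by rewrite bd_bd raddf0.
    rewrite !ext_ext.
    by apply: eq_ext (@supported_bd _ s) _ => t /fface[].
  rewrite prednK // in cP.
  by exists c; split=> [s0|_]; [rewrite s0 in s_gt0 | split].
exists f; split=> [|s Ks|s Ks]; first exact: (fQ [::]).1.
  by have [] := (fQ s).2 Ks.
by have [] := (fQ s).2 Ks.
Qed.

(** Uniqueness half of the acyclic carrier theorem: [f s - g s - ext h (bd s)] is a cycle of
    [Phi s], because the homotopy identity on the faces makes its boundary equal to [h] applied to
    the double boundary of [s]. The homotopy starts from zero on the empty simplex, where [f] and
    [g] agree. *)
Lemma carrier_homotopic K L Phi f g : subcomplex K -> acyclic_carrier K Phi ->
    (forall s u, K s -> Phi s u -> L u) ->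
    carries K Phi f -> carries K Phi g -> f [::] = g [::] ->
    (forall s, K s -> ext bd (f s) = ext f (bd s)) ->
    (forall s, K s -> ext bd (g s) = ext g (bd s)) ->
  homotopic K L f g.
Proof.
move=> subK [acPhi monoPhi] PhiL cf cg fg0 bf bg.
pose Q s (h : seq X -> chains Y) y := K s ->
  supported (of_size (Phi s) (size s).+1) y /\
  f s - g s = ext bd y + ext h (bd s).
have [|s h IH|h hQ] := @size_rec_choice _ _ size 0 Q.
- move=> s h h' y hh Q1 Ks; have [Q2 ->] := Q1 Ks; split=> //; congr (_ + _).
  by apply: eq_ext (@supported_bd _ s) _ => t [_ szt]; apply: hh; rewrite -szt.
- have [Ks|nKs] := EM (K s); last by exists 0.
  have [s0|s_gt0] := posnP (size s).
    rewrite (size0nil s0); exists 0 => _; split; first exact: supported0.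
    by rewrite fg0 subrr !raddf0 addr0.
  have hface t : face t s -> supported (of_size (Phi t) (size t).+1) (h t) /\
      f t - g t = ext bd (h t) + ext h (bd t).
    move=> [ts szt]; have Kt : K t by apply: subK ts.
    by have := IH t; rewrite -szt ltnS leqnn => /(_ isT Kt).
  have [|| c cP bc] := acPhi s Ks s_gt0 (size s) (f s - g s - ext h (bd s)).
  + apply: supportedB; first by apply: supportedB; [apply: cf|apply: cg].
    apply: supported_ext (@supported_bd _ s) _ => t ft.
    have [ct _] := hface t ft; have [ts szt] := ft.
    apply: supported_sub ct => u [Pu szu]; split; last by rewrite szu -szt.
    exact: (monoPhi _ _ Ks ts _ Pu).
  + transitivity (ext h (ext bd (bd s))); last by rewrite bd_bd raddf0.
    rewrite !raddfB /= bf // bg // -extBl !ext_ext -extBl.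
    apply: eq_ext (@supported_bd _ s) _ => t /hface[_ ->].
    by rewrite addrC addKr.
  by exists c => _; split; rewrite // bc subrK.
exists h; split=> s Ks; last by have [] := hQ s Ks.
by apply: supported_sub (hQ s Ks).1 => u [Pu szu]; split=> //; apply: PhiL Pu.
Qed.

Lemma chain_map_subl K K' L f : (forall s, K' s -> K s) ->
  chain_map K L f -> chain_map K' L f.
Proof. by move=> KK [fL bf]; split=> s /KK Ks; [apply: fL | apply: bf]. Qed.

Lemma chain_map_subr K L L' f : (forall s, L s -> L' s) ->
  chain_map K L f -> chain_map K L' f.
Proof.
move=> LL [fL bf]; split=> // s Ks.
by apply: supported_sub (fL s Ks) => t [/LL].
Qed.

Lemma ext_chain_map K L f z : chain_map K L f -> supported K z ->
  ext bd (ext f z) = ext f (ext bd z).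
Proof.
by move=> [_ bf] Kz; rewrite !ext_ext; apply: eq_ext Kz bf.
Qed.

Lemma homotopic_trans K L f g h :
  homotopic K L f g -> homotopic K L g h -> homotopic K L f h.
Proof.
move=> [p [pL pP]] [q [qL qP]]; exists (fun s => p s + q s); split=> s Ks.
  by apply: supportedD; [apply: pL|apply: qL].
rewrite raddfD /= extDl addrACA -pP // -qP //.
by rewrite addrA subrK.
Qed.

End ChainMaps.

Section Composition.
Variables X Y Z : choiceType.
Variables (K : seq X -> Prop) (L : seq Y -> Prop) (M : seq Z -> Prop).

Lemma chain_map_comp f g : chain_map K L f -> chain_map L M g ->
  chain_map K M (fun s => ext g (f s)).
Proof.
move=> [fL bf] [gM bg]; split=> s Ks.
  by apply: supported_ext (fL s Ks) _ => u [Lu <-]; apply: gM.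
rewrite (ext_chain_map (conj gM bg)) ?bf // ?ext_ext //.
by apply: supported_sub (fL s Ks) => u [].
Qed.

Lemma homotopic_post f g (h : seq Y -> chains Z) : chain_map L M h ->
  homotopic K L f g -> homotopic K M (fun s => ext h (f s)) (fun s => ext h (g s)).
Proof.
move=> ch [p [pL pP]]; exists (fun s => ext h (p s)); split=> s Ks.
  by apply: supported_ext (pL s Ks) _ => u [Lu <-]; apply ch.1.
rewrite -raddfB pP // raddfD /= (ext_chain_map ch) ?ext_ext //.
by apply: supported_sub (pL s Ks) => u [].
Qed.

Lemma homotopic_pre f (g h : seq Y -> chains Z) : chain_map K L f ->
  homotopic L M g h -> homotopic K M (fun s => ext g (f s)) (fun s => ext h (f s)).
Proof.
move=> cf [p [pL pP]]; exists (fun s => ext p (f s)); split=> s Ks.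
  by apply: supported_ext (cf.1 s Ks) _ => u [Lu <-]; apply: pL.
rewrite -[ext (fun _ => _) (bd s)]ext_ext -cf.2 // !ext_ext -extBl -extDl.
by apply: eq_ext (cf.1 s Ks) _ => u [Lu _]; apply: pP.
Qed.

End Composition.

(** Meant for [p] a round trip from a Vietoris complex through another finite complex: such a detour
    does not change the homotopy class of the composite. *)
Lemma homotopic_through (X Y : choiceType) (K : seq X -> Prop) (L : seq Y -> Prop)
    (f : seq X -> chains Y) (p : seq Y -> chains Y) (g : seq Y -> chains X) :
  chain_map K L f -> chain_map L K g -> homotopic L L p (fun t => << t >>) ->
  homotopic K K (fun s => ext g (f s)) (fun s => << s >>) ->
  homotopic K K (fun s => ext g (ext p (f s))) (fun s => << s >>).
Proof.
move=> cf cg hp; apply: homotopic_trans.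
rewrite (_ : (fun s => ext g (f s)) = (fun s => ext g (ext (fun t => << t >>) (f s)))).
  exact: homotopic_post cg (homotopic_pre cf hp).
by apply/funext => s; rewrite ext_id.
Qed.

(** * The supertrace of a finite complex *)

Section FiniteComplexes.
Variable V : finType.
Implicit Types (s t : seq V) (K : {set {set V}}) (A B : {set V}).

Lemma enum_filter A : enum A = [seq x <- enum V | x \in A].
Proof. by rewrite enumT. Qed.

Definition down_closed K := forall A B, A \in K -> B \subset A -> B \in K.

(* The oriented chains of K are spanned by its simplices listed in the order of
   enum V. *)
Definition simplices K s := subseq s (enum V) /\ [set x in s] \in K.

(** The negative of the reduced Euler characteristic: a face counts by its number of vertices, and
    the empty face counts 1. *)
Definition euler K : int := \sum_(A in K) (-1) ^+ #|A|.

Lemma simplices_enum K A : A \in K -> simplices K (enum A).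
Proof.
move=> KA; split; first by rewrite enum_filter filter_subseq.
by rewrite (_ : [set x in _] = A) //; apply/setP => x; rewrite inE mem_enum.
Qed.

Lemma enum_simplices K s : simplices K s -> s = enum [set x in s].
Proof.
move=> [/(subseq_uniqP (enum_uniq V)) sE _]; rewrite enum_filter [LHS]sE.
by apply: eq_filter => x; rewrite inE.
Qed.

Lemma subcomplex_simplices K : down_closed K -> subcomplex (simplices K).
Proof.
move=> dK s t [sV Ks] ts; split; first exact: subseq_trans ts sV.
apply: dK Ks _; apply/subsetP => x; rewrite !inE; exact: mem_subseq.
Qed.

Lemma simplices_bd K s : down_closed K -> simplices K s -> supported (simplices K) (bd s).
Proof.
move=> dK Ks; apply: supported_sub (@supported_bd _ s) => t [ts _].
exact: subcomplex_simplices ts.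
Qed.

(** Replaces the varying domain of [z] by the fixed basis of faces of [K], so that composition
    becomes a matrix product whose sums can be exchanged. *)
Lemma coeff_ext_simplices K (Y : choiceType) (g : seq V -> chains Y) z u :
  supported (simplices K) z ->
  coeff u (ext g z) = \sum_(A in K) coeff (enum A) z * coeff u (g (enum A)).
Proof.
move=> Kz; pose l := [seq enum (mem A) | A : {set V} <- enum K].
rewrite coeff_ext -[RHS]big_enum -[RHS](big_map (fun A : {set V} => enum A) xpredT
  (fun s => coeff s z * coeff u (g s))) -/l.
rewrite [RHS](bigID (mem (dom z))) /= addrC [X in _ = X + _]big1 ?add0r; last first.
  by move=> s /coeff_outdom ->; rewrite mul0r.
rewrite -[RHS]big_filter; apply: perm_big; apply: uniq_perm.
- exact: uniq_dom.
- rewrite filter_uniq // map_inj_uniq ?enum_uniq // => A B eAB.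
  by apply/setP => x; rewrite -mem_enum eAB mem_enum.
- move=> s; rewrite mem_filter; case: (boolP (s \in dom z)) => //= sz.
  have Ks := Kz s sz; apply/esym/mapP; exists [set x in s].
    by rewrite mem_enum; apply: Ks.2.
  exact: enum_simplices Ks.
Qed.

End FiniteComplexes.

Definition supertrace (V : finType) (K : {set {set V}}) (f : seq V -> chains V) : int :=
  \sum_(A in K) (-1) ^+ #|A| * coeff (enum A) (f (enum A)).

(** Graded cyclicity of the trace. An entry of [f] from A to B vanishes unless the parity of B is
    that of A shifted by [e], and the sign sees nothing else. It serves with [e = false] for two
    chain maps and with [e = true] for a homotopy against [bd]. *)
Lemma supertrace_comp (V W : finType) (K : {set {set V}}) (L : {set {set W}})
    (f : seq V -> chains W) (g : seq W -> chains V) (e : bool) :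
  (forall s, simplices K s ->
     supported (fun t => simplices L t /\ odd (size t) = e (+) odd (size s)) (f s)) ->
  (forall t, simplices L t -> supported (simplices K) (g t)) ->
  supertrace L (fun t => ext f (g t)) = (-1) ^+ e * supertrace K (fun s => ext g (f s)).
Proof.
move=> fL gK; rewrite /supertrace mulr_sumr.
under eq_bigr => B LB.
  rewrite (coeff_ext_simplices _ _ (gK _ (simplices_enum LB))) mulr_sumr.
over.
rewrite exchange_big; apply: eq_bigr => A KA /=.
have fA := fL _ (simplices_enum KA).
rewrite (coeff_ext_simplices (K := L)); last by apply: supported_sub fA => t [].
rewrite !mulr_sumr; apply: eq_bigr => B LB.
case: (boolP (enum B \in dom (f (enum A)))) => [/fA[_]|/coeff_outdom ->].
  rewrite -!cardE => oB; rewrite -[in LHS]signr_odd oB signr_addb signr_odd.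
  by rewrite !mulrA mulrAC.
by rewrite !(mulr0, mul0r).
Qed.

(** The homotopy [h] is odd, so the supertraces of [bd] after [h] and of [h] after [bd] are
    opposite; the difference between [f] and the identity has supertrace zero. *)
Lemma supertrace_homotopic (V : finType) (K : {set {set V}}) (f : seq V -> chains V) :
  down_closed K -> homotopic (simplices K) (simplices K) f (fun s => << s >>) ->
  supertrace K f = euler K.
Proof.
move=> dK [h [hK hP]].
have strE : supertrace K (fun s => ext bd (h s)) = - supertrace K (fun s => ext h (bd s)).
  rewrite (@supertrace_comp V V K K h bd true) ?expr1 ?mulN1r ?opprK //.
    move=> s Ks; apply: supported_sub (hK s Ks) => t [Kt ->]; split=> //.
  by move=> t; apply: simplices_bd.
apply/eqP; rewrite -subr_eq0 /euler /supertrace -sumrB; apply/eqP.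
transitivity (supertrace K (fun s => ext bd (h s)) + supertrace K (fun s => ext h (bd s))).
  rewrite /supertrace -big_split; apply: eq_bigr => A KA.
  have := congr1 (coeff (enum A)) (hP _ (simplices_enum KA)).
  rewrite coeffB coeffD coeffU eqxx mulr1 => hE.
  by rewrite -[RHS]mulrDr -hE mulrBr mulr1.
by rewrite strE addNr.
Qed.

(** The Hopf trace argument on chains, without passing to homology: the two round trips have the
    same supertrace, and each is homotopic to an identity. *)
Lemma euler_homotopy_invariant (V W : finType) (K : {set {set V}}) (L : {set {set W}})
    (f : seq V -> chains W) (g : seq W -> chains V) :
  down_closed K -> down_closed L ->
  chain_map (simplices K) (simplices L) f -> chain_map (simplices L) (simplices K) g ->
  homotopic (simplices K) (simplices K) (fun s => ext g (f s)) (fun s => << s >>) ->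
  homotopic (simplices L) (simplices L) (fun t => ext f (g t)) (fun t => << t >>) ->
  euler K = euler L.
Proof.
move=> dK dL cf cg gf fg.
rewrite -(supertrace_homotopic dK gf) -(supertrace_homotopic dL fg).
rewrite (@supertrace_comp V W K L f g false) ?expr0 ?mul1r //.
  by move=> s /cf.1; apply: supported_sub => t [Lt ->].
by move=> t /cg.1; apply: supported_sub => s [].
Qed.

(** * Vietoris complexes of a realization *)

Section Pushforward.
Variables (X Y : choiceType) (f : X -> Y).

Definition push (s : seq X) : chains Y := << map f s >>.

Lemma bd_push s : bd (map f s) = ext push (bd s).
Proof.
elim: s => [|x s IHs] /=; first by rewrite raddf0.
rewrite raddfB /= extU IHs !ext_ext; congr (_ - _).
by apply: (eq_ext (P := xpredT)) => // t _; rewrite /cone !extU.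
Qed.

Lemma ext_bd_push z : ext bd (ext push z) = ext push (ext bd z).
Proof.
rewrite !ext_ext; apply: (eq_ext (P := xpredT)) => // s _.
by rewrite extU bd_push.
Qed.

End Pushforward.

Lemma homotopic_cycle (X Y : choiceType) (K : seq X -> Prop) (L : seq Y -> Prop)
    (f g : seq X -> chains Y) n z :
  homotopic K L f g -> supported (of_size K n) z -> ext bd z = 0 ->
  exists2 c, supported (of_size L n.+1) c & ext bd c = ext f z - ext g z.
Proof.
move=> [h [hL hP]] Kz z0; exists (ext h z).
  by apply: supported_ext Kz _ => s [Ks <-]; apply: hL.
transitivity (ext bd (ext h z) + ext h (ext bd z)).
  by rewrite z0 raddf0 addr0.
rewrite !ext_ext -extDl -extBl.
by apply: eq_ext Kz _ => s [Ks _]; rewrite hP.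
Qed.

Lemma seq_lt_gap (R : realFieldType) (l : seq R) (e : R) :
  all (fun x => x < e) l -> exists2 h, 0 < h & all (fun x => x < e - h) l.
Proof.
elim: l => [_|x l IHl /= /andP[xe /IHl[h h0 lh]]]; first by exists 1.
exists (Num.min h ((e - x) / 2)).
  by rewrite lt_min h0 divr_gt0 ?subr_gt0.
apply/andP; split.
  have : Num.min h ((e - x) / 2) <= (e - x) / 2 by rewrite ge_min lexx orbT.
  lra.
apply: sub_all lh => y /lt_le_trans; apply.
by rewrite lerB // ge_min lexx.
Qed.

(** The point set [X] is abstract so that two complexes can have coordinates over the same points.
    No topology is recorded: it enters only when the scales of two systems of coordinates are
    compared. *)
Record barycentric (R : realType) (V : finType) (K : {set {set V}}) (X : Type)
    (a : X -> V -> R) : Prop := Barycentric {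
  bary_ge0 : forall x v, 0 <= a x v;
  bary_sum : forall x, \sum_v a x v = 1;
  bary_supp : forall x, [set v | a x v != 0] \in K;
  bary_inj : forall x y, a x =1 a y -> x = y;
  bary_surj : forall p : V -> R, (forall v, 0 <= p v) -> \sum_v p v = 1 ->
    [set v | p v != 0] \in K -> exists x, a x =1 p }.

Section Vietoris.
Variables (R : realType) (V : finType) (K : {set {set V}}) (X : choiceType).
Variable a : X -> V -> R.
Hypothesis aK : barycentric K a.
Implicit Types (d e : R) (S : pred X) (x y : X) (v w : V).

Definition supp x := [set v | a x v != 0].

Definition close d (s : seq X) :=
  forall x y v, x \in s -> y \in s -> `|a x v - a y v| < d.

(* Tuples may repeat points, so that every map of points induces a chain map. *)
Definition vietoris d S s := all S s /\ close d s.

Lemma bary_le1 x v : a x v <= 1.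
Proof.
rewrite -(bary_sum aK x) (bigD1 v) //= lerDl sumr_ge0 // => w _.
exact: bary_ge0 aK x w.
Qed.

Lemma subcomplex_vietoris d S : subcomplex (vietoris d S).
Proof.
move=> s t [Ss ds] ts; have st := mem_subseq ts; split.
  by apply/allP => x /st xs; apply: (allP Ss).
by move=> x y v /st xs /st ys; apply: ds.
Qed.

Lemma vietoris_le d e S s : d <= e -> vietoris d S s -> vietoris e S s.
Proof.
move=> de [Ss ds]; split=> // x y v xs ys.
exact: lt_le_trans (ds x y v xs ys) de.
Qed.

(** A chain involves finitely many distances, so their strict bounds leave a common margin [h]; the
    steps of a contraction will be paid out of it. *)
Lemma vietoris_gap d S n z : supported (of_size (vietoris d S) n) z ->
  exists2 h, 0 < h & supported (of_size (vietoris (d - h) S) n) z.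
Proof.
move=> Sz.
pose dist s : seq R := [seq `|a xy.1 v - a xy.2 v| | xy <- [seq (x, y) | x <- s, y <- s],
                                                    v <- enum V].
have [|h h0 zh] := @seq_lt_gap R (flatten [seq dist s | s <- dom z]) d.
  apply/allP => r /flattenP[l /mapP[s sz ->]] /allpairsP[[[x y] v] /= [xy _ ->]].
  have [[_ ds] _] := Sz s sz.
  by case/allpairsP: xy => -[x' y'] /= [xs ys [-> ->]]; apply: ds.
exists h => //; split=> s sz; have [[Ss ds] szs] := Sz s sz; split=> //; split=> //.
move=> x y v xs ys; apply: (allP zh); apply/flattenP; exists (dist s).
  exact: map_f.
apply/allpairsP; exists ((x, y), v); rewrite /= mem_enum; split=> //.
by apply/allpairsP; exists (x, y).
Qed.

(* Contract linearly towards the vertex v, in steps so small that consecutive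
   maps are contiguous on the given cycle. *)
Lemma starshaped_acyclic d S c v : 0 < d -> S c -> a c =1 (fun w => (w == v)%:R) ->
  (forall x l, S x -> 0 <= l <= 1 ->
     exists2 y, S y & forall w, a y w = (1 - l) * a x w + l * (w == v)%:R) ->
  acyclic (vietoris d S).
Proof.
move=> d0 Sc ac star n z Sz z0.
have [h h0 Shz] := vietoris_gap Sz.
(* One step of the contraction moves each coordinate by at most [1/(N+1)], which stays within the
   margin [h]. *)
have [N] := ltr_add_invr h0; rewrite add0r => Nh.
pose lam (i : nat) : R := i%:R / N.+1%:R.
have lamP i : (i <= N.+1)%N -> 0 <= lam i <= 1.
  move=> iN; rewrite divr_ge0 ?ler0n //= ler_pdivrMr ?ltr0n // mul1r.
  by rewrite ler_nat.
have /choice[m mP] (ix : nat * X) : exists y, S ix.2 -> (ix.1 <= N.+1)%N ->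
    S y /\ forall w, a y w = (1 - lam ix.1) * a ix.2 w + lam ix.1 * (w == v)%:R.
  case: ix => i x /=.
  have [[Sx iN]|H] := EM (S x /\ (i <= N.+1)%N).
    by have [y Sy yP] := star x _ Sx (lamP i iN); exists y.
  by exists x => Sx iN; case: H.
pose mi i x := m (i, x).
have miS i x : S x -> (i <= N.+1)%N -> S (mi i x).
  by move=> Sx iN; have [] := mP (i, x) Sx iN.
have mia i x w : S x -> (i <= N.+1)%N ->
    a (mi i x) w = (1 - lam i) * a x w + lam i * (w == v)%:R.
  by move=> Sx iN; have [_] := mP (i, x) Sx iN; apply.
have bdz i : ext bd (ext (push (mi i)) z) = 0.
  by rewrite ext_bd_push z0 raddf0.
have steps i : (i <= N.+1)%N -> exists2 c,
    supported (of_size (vietoris d S) n.+1) c & ext bd c = z - ext (push (mi i)) z.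
  elim: i => [_|i IHi iN].
    exists 0; first exact: supported0.
    rewrite raddf0 -{1}[z]ext_id -extBl; apply/esym.
    rewrite extE big_seq big1 // => s sz; have [[Ss _] _] := Sz s sz.
    rewrite /push [map _ _](_ : _ = s) ?subrr ?scaler0 //.
    rewrite -[RHS]map_id; apply/eq_in_map => x xs; apply: (bary_inj aK) => w.
    by rewrite mia ?(allP Ss) // /lam mul0r subr0 mul1r mul0r addr0.
  have [c1 Sc1 bc1] := IHi (ltnW iN).
  have ht : homotopic (vietoris (d - h) S) (vietoris d S) (push (mi i)) (push (mi i.+1)).
    (* Tuples drawn from the images of [s] under two consecutive maps. As repetitions are allowed
       they form a full simplex, hence an acyclic carrier of both maps. *)
    pose Phi (s u : seq X) := all (mem (map (mi i) s ++ map (mi i.+1) s)) u : Prop.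
    apply: (carrier_homotopic (Phi := Phi)).
    - exact: subcomplex_vietoris.
    - split=> [[//|x s] _ _|s t _ ts u].
        by apply: (@full_acyclic _ _ (mi i x)); apply: mem_head.
      apply: sub_all => x /=; rewrite !mem_cat.
      by case/orP => /mapP[y /(mem_subseq ts) ys ->]; rewrite map_f ?orbT.
    - move=> s u [Ss ds] /allP su.
      have suP x : x \in u -> exists2 x0, x0 \in s &
          exists2 j, (i <= j <= i.+1)%N & x = mi j x0.
        move=> /su /=; rewrite mem_cat => /orP[] /mapP[x0 x0s ->]; exists x0 => //.
          by exists i; rewrite ?leqnn ?leqnSn.
        by exists i.+1; rewrite ?leqnn ?leqnSn.
      split.
        apply/allP => x /suP[x0 /(allP Ss) Sx0 [j /andP[_ ji] ->]].
        exact: miS (leq_trans ji iN).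
      move=> x y w /suP[x0 x0s [j /andP[ij ji] ->]] /suP[y0 y0s [j' /andP[ij' ji'] ->]].
      rewrite !mia ?(allP Ss) ?(leq_trans _ iN) //.
      have -> : (1 - lam j) * a x0 w + lam j * (w == v)%:R -
          ((1 - lam j') * a y0 w + lam j' * (w == v)%:R) =
        (1 - lam j) * (a x0 w - a y0 w) + (lam j - lam j') * ((w == v)%:R - a y0 w).
        by ring.
      apply: le_lt_trans (ler_normD _ _) _.
      rewrite -(subrK h d); apply: ltr_leD.
        apply: le_lt_trans (ds x0 y0 w x0s y0s); rewrite normrM ler_piMl //.
        have /andP[l0 l1] := lamP j (leq_trans ji iN).
        by rewrite ger0_norm ?subr_ge0 // gerBl.
      apply: le_trans (ltW Nh); rewrite normrM.
      apply: le_trans (_ : `|lam j - lam j'| * 1 <= _).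
        rewrite ler_wpM2l //; have := bary_ge0 aK y0 w; have := bary_le1 y0 w.
        by case: (w == v); rewrite /= ler_norml => ? ?; apply/andP; split; lra.
      rewrite mulr1 -mulrBl normrM normfV [`|N.+1%:R|]ger0_norm //.
      rewrite ler_pdivrMr ?ltr0n // mulVf ?pnatr_eq0 //.
      rewrite (_ : _ - _ = (j%:Z - j'%:Z)%:~R); last by rewrite intrB.
      rewrite -intr_norm -[1]/(1%:~R) ler_int; lia.
    - move=> s _; apply: supportedU; split; last exact: size_map.
      by apply/allP => x xs; rewrite /= mem_cat xs.
    - move=> s _; apply: supportedU; split; last exact: size_map.
      by apply/allP => x xs; rewrite /= mem_cat xs orbT.
    - by [].
    - by move=> s _; rewrite extU bd_push.
    - by move=> s _; rewrite extU bd_push.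
  have [c2 Sc2 bc2] := homotopic_cycle ht Shz z0.
  exists (c1 + c2); first exact: supportedD.
  by rewrite raddfD /= bc1 bc2 addrA subrK.
have [c1 Sc1 bc1] := steps _ (leqnn _).
(* The last map is constant at [c], so the cycle it produces is filled by coning from [c]. *)
exists (c1 + ext (cone c) (ext (push (mi N.+1)) z)); last first.
  by rewrite raddfD /= bd_cone bdz raddf0 subr0 bc1 subrK.
apply: supportedD => //; rewrite ext_ext.
apply: supported_ext Sz _ => s [[Ss _] <-]; rewrite /push /cone extU.
have mc x : x \in s -> mi N.+1 x = c.
  move=> xs; apply: (bary_inj aK) => w; rewrite mia ?(allP Ss) // ac.
  by rewrite /lam divff ?pnatr_eq0 // subrr mul0r add0r mul1r.
have cP x : x \in c :: map (mi N.+1) s -> x = c.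
  by rewrite inE => /predU1P[//|/mapP[y ys ->]]; apply: mc.
apply: supportedU; split; last by rewrite /= size_map.
split; first by apply/allP => x /cP ->.
by move=> x y w /cP -> /cP ->; rewrite subrr normr0.
Qed.

End Vietoris.

(** * Comparison of a finite complex with its Vietoris complexes *)

Section VietorisModel.
Variables (R : realType) (V : finType) (K : {set {set V}}) (X : choiceType).
Variable a : X -> V -> R.
Hypothesis dK : down_closed K.
Hypothesis K0 : set0 \in K.
Hypothesis aK : barycentric K a.
Implicit Types (d e : R) (S : pred X) (x y : X) (v w : V).

Local Notation supp := (supp a).
Local Notation viet d := (vietoris a d xpredT).

(** Some coordinate of every point is at least [mesh], since all the coordinates sum to 1; a point
    closer than [mesh] to it still has this coordinate nonzero. The successor keeps [mesh] positive
    even for empty [V]. *)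
Definition mesh : R := (#|V|.+1)%:R^-1.

Lemma mesh_gt0 : 0 < mesh.
Proof. by rewrite invr_gt0 ltr0n. Qed.

Lemma large_coordinate x : exists v, mesh <= a x v.
Proof.
apply/not_existsP => H.
have : \sum_v a x v <= \sum_(v : V) mesh.
  by apply: ler_sum => v _; rewrite leNgt; apply/negP => /ltW /H.
rewrite (bary_sum aK) sumr_const -[_ *+ _]mulr_natr ler_pdivlMl ?ltr0n //.
by rewrite mulr1 ler_nat ltnn.
Qed.

Lemma in_supp x v : (v \in supp x) = (a x v != 0).
Proof. by rewrite inE. Qed.

Lemma supp_neq0 x : exists v, v \in supp x.
Proof.
have [v xv] := large_coordinate x; exists v; rewrite in_supp.
by rewrite gt_eqF // (lt_le_trans mesh_gt0).
Qed.

(** Only an inclusion of supports can hold: at [l = 1] the segment reaches the vertex [v] itself. *)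
Lemma bary_segment v x l : v |: supp x \in K -> 0 <= l <= 1 ->
  exists2 y, supp y \subset v |: supp x &
    a y =1 (fun w => (1 - l) * a x w + l * (w == v)%:R).
Proof.
move=> Kvx /andP[l0 l1]; pose p w := (1 - l) * a x w + l * (w == v)%:R.
have sp : [set w | p w != 0] \subset v |: supp x.
  apply/subsetP => w; rewrite !inE; apply: contraNT.
  rewrite negb_or negbK /p => /andP[/negPf -> /eqP ->].
  by rewrite !mulr0 addr0.
have [||| y yp] := bary_surj aK (p := p).
- move=> w; rewrite addr_ge0 // mulr_ge0 ?ler0n ?subr_ge0 //.
  exact: bary_ge0 aK x w.
- rewrite big_split /= -!mulr_sumr (bary_sum aK) (bigD1 v) //= eqxx big1.
    by rewrite addr0 !mulr1 subrK.
  by move=> w /negPf ->.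
- exact: dK Kvx sp.
exists y => //; apply/subsetP => w; rewrite in_supp yp => pw.
by apply: (subsetP sp); rewrite inE.
Qed.

(** The hypotheses say that [S] is a union of closed faces, each of which can be joined to [v]
    inside [S]; segments towards [v] then stay in [S]. *)
Lemma star_acyclic d S v : 0 < d -> [set v] \in K ->
  (forall y, supp y \subset [set v] -> S y) ->
  (forall x, S x -> v |: supp x \in K) ->
  (forall x y, S x -> supp y \subset v |: supp x -> S y) ->
  acyclic (vietoris a d S).
Proof.
move=> d0 Kv Sv SK Sstar.
have pv : [set w | (w == v)%:R != 0 :> R] = [set v].
  by apply/setP => w; rewrite !inE; case: (w == v); rewrite ?oner_eq0 ?eqxx.
have [||| c cv] := bary_surj aK (p := fun w => (w == v)%:R).
- by move=> w; rewrite ler0n.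
- by rewrite (bigD1 v) //= eqxx big1 ?addr0 // => w /negPf ->.
- by rewrite pv.
have Sc : S c by apply: Sv; rewrite -pv; apply/subsetP => w; rewrite in_supp cv inE.
apply: (starshaped_acyclic aK d0 Sc cv).
move=> x l Sx l01; have [y yx yE] := bary_segment (SK x Sx) l01.
by exists y => //; apply: Sstar yx.
Qed.

Definition supp_in (A : {set V}) : pred X := fun x => supp x \subset A.

Lemma supp_in_acyclic d (A : {set V}) : 0 < d -> A \in K -> A != set0 ->
  acyclic (vietoris a d (supp_in A)).
Proof.
move=> d0 KA /set0Pn[v vA].
have vsub x : supp_in A x -> v |: supp x \subset A by rewrite subUset sub1set vA.
apply: (star_acyclic d0 (v := v)).
- by apply: dK KA _; rewrite sub1set.
- by move=> y /subset_trans; apply; rewrite sub1set.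
- by move=> x /vsub; apply: dK.
- by move=> x y /vsub vx /subset_trans; apply.
Qed.

(** This replaces iterated subdivision: the vertices of [s] are far apart, but the closed face they
    span is acyclic at scale [d], so it contains a chain of small tuples extending the one chosen on
    its boundary. *)
Lemma realize_simplices d : 0 < d -> exists f : seq V -> chains X,
  [/\ f [::] = << [::] >>,
      carries (simplices K) (fun s => vietoris a d (supp_in [set v in s])) f &
      forall s, simplices K s -> ext bd (f s) = ext f (bd s)].
Proof.
move=> d0; apply: carrier_chain_map; first exact: subcomplex_simplices.
  split=> [s [_ Ks] s0|s t _ ts u [su du]].
    apply: supp_in_acyclic => //; apply/set0Pn.
    by case: s s0 {Ks} => // v s _; exists v; rewrite inE mem_head.
  split=> //; apply: sub_all su => x /subset_trans; apply.
  by apply/subsetP => v; rewrite !inE; apply: mem_subseq.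
by split.
Qed.

(* Round a point to a vertex at which it has a large barycentric coordinate. *)
Lemma round_points : exists r : X -> V, forall d t x y, d <= mesh ->
  vietoris a d xpredT t -> x \in t -> y \in t -> r x \in supp y.
Proof.
have /choice[r rP] := large_coordinate; exists r => d t x y dm [_ dt] xt yt.
rewrite in_supp gt_eqF //.
have := dt x y (r x) xt yt; rewrite ltr_norml => /andP[_].
have := rP x; have := dm; lra.
Qed.

(** One [g] serves all scales up to [mesh], whereas [f] depends on the scale it has to reach. In the
    last clause [f] may be finer than the complex on which the round trip is compared with the
    identity, as interleaving requires. *)
Lemma vietoris_model : exists (f : R -> seq V -> chains X) (g : seq X -> chains V),
  [/\ forall d, 0 < d -> chain_map (simplices K) (viet d) (f d),
      forall d, d <= mesh -> chain_map (viet d) (simplices K) g,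
      forall d, 0 < d -> d <= mesh ->
        homotopic (simplices K) (simplices K) (fun s => ext g (f d s)) (fun s => << s >>) &
      forall d e, 0 < d -> d <= e -> e <= mesh ->
        homotopic (viet e) (viet e) (fun s => ext (f d) (g s)) (fun s => << s >>)].
Proof.
have /choice[f fP] (d : R) : exists f, 0 < d -> [/\ f [::] = << [::] >>,
      carries (simplices K) (fun s => vietoris a d (supp_in [set v in s])) f &
      forall s, simplices K s -> ext bd (f s) = ext f (bd s)].
  have [/realize_simplices[h hP]|d0] := EM (0 < d); first by exists h.
  by exists (fun=> 0).
have [r rP] := round_points.
pose verts t := [set v in map r t].
have vertsS d t x : d <= mesh -> viet d t -> x \in t -> verts t \subset supp x.
  move=> dm dt xt; apply/subsetP => v; rewrite inE => /mapP[y yt ->].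
  exact: rP dt yt xt.
have vertsK d t : d <= mesh -> viet d t -> verts t \in K.
  move=> dm; case: t => [_|x t dt].
    by rewrite (_ : verts _ = set0) //; apply/setP => v; rewrite !inE.
  by apply: dK (bary_supp aK x) _; apply: vertsS dt _; rewrite ?mem_head.
have sub_enum (A B : {set V}) : A \subset B -> subseq (enum A) (enum B).
  move=> /subsetP AB; rewrite !enum_filter subseq_filter filter_subseq andbT.
  by apply/allP => v; rewrite mem_filter => /andP[/AB].
have fm d : 0 < d -> chain_map (simplices K) (viet d) (f d).
  move=> d0; have [_ cf bf] := fP d d0.
  by apply: chain_map_carries cf bf => s u _ [_ du]; split=> //; apply/allP.
(* Rounding a tuple pointwise may repeat vertices or break the order of [enum V]; a carrier made of
   the ordered faces of the rounded simplex avoids choosing signs by hand. *)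
have [g [g0 cg bg]] : exists g : seq X -> chains V,
    [/\ g [::] = << [::] >>, carries (viet mesh) (fun t u => subseq u (enum (verts t))) g &
     forall t, viet mesh t -> ext bd (g t) = ext g (bd t)].
  apply: carrier_chain_map; first exact: subcomplex_vietoris.
    split=> [[//|x t] _ _|s t _ ts u ut].
      case eV: (enum (verts (x :: t))) (enum_uniq (verts (x :: t))) => [|v l] Ul.
        by have := mem_enum (verts (x :: t)) (r x); rewrite eV inE mem_head.
      exact: subseq_acyclic.
    apply: subseq_trans ut _; apply: sub_enum; apply/subsetP => v.
    by rewrite !inE => /mapP[y /(mem_subseq ts) ys ->]; apply: map_f.
  by rewrite (_ : verts _ = set0) ?enum_set0 //; apply/setP => v; rewrite !inE.
have gsimp t u : viet mesh t -> subseq u (enum (verts t)) -> simplices K u.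
  move=> mt ut; apply: subcomplex_simplices ut => //.
  by apply: simplices_enum; apply: vertsK mt.
have gm d : d <= mesh -> chain_map (viet d) (simplices K) g.
  move=> dm; split=> t dt; last by apply: bg; apply: vietoris_le dt.
  have mt := vietoris_le dm dt.
  by apply: supported_sub (cg t mt) => u [ut szu]; split=> //; apply: gsimp mt ut.
exists f, g; split=> // [d d0 dm|d e d0 de em].
- have [f0 cf bf] := fP d d0.
  have cgf := chain_map_comp (fm d d0) (gm d dm).
  apply: (carrier_homotopic (Phi := fun s u => subseq u s)).
  + exact: subcomplex_simplices.
  + split=> [[//|v s] [sV _] _|s t _ ts u ut]; last exact: subseq_trans ut ts.
    by apply: subseq_acyclic; apply: subseq_uniq sV (enum_uniq V).
  + by move=> s u Ks us; apply: subcomplex_simplices us.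
  + move=> s Ks; apply: supported_ext (cf s Ks) _ => t [[st dt] <-].
    have mt : viet mesh t by apply: vietoris_le dm _; split=> //; apply/allP.
    apply: supported_sub (cg t mt) => u [ut szu]; split=> //.
    apply: subseq_trans ut _; rewrite (enum_simplices Ks); apply: sub_enum.
    apply/subsetP => v; rewrite [v \in verts t]inE => /mapP[x xt ->].
    by apply: (subsetP (allP st x xt)); exact: (rP _ _ _ _ (lexx _) mt xt xt).
  + by move=> s _; apply: supportedU.
  + by rewrite f0 extU g0.
  + exact: cgf.2.
  + by move=> s _; rewrite extU ext_id.
- have dm := le_trans de em; have [f0 cf bf] := fP d d0.
  have cfg := chain_map_comp (gm e em) (fm d d0).
  (* The union of the closed faces spanned by the supports of the points of [t]. All of them contain
     the rounded vertex of any point of [t], so the union is star-shaped about it. *)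
  pose St (t : seq X) : pred X := fun x => has (fun y => supp x \subset supp y) t.
  apply: (carrier_homotopic (Phi := fun t => vietoris a e (St t))).
  + exact: subcomplex_vietoris.
  + split=> [[//|x0 t] et _|s t _ ts u [tu eu]]; last first.
      split=> //; apply: sub_all tu => x /hasP[y /(mem_subseq ts) ys xy].
      by apply/hasP; exists y.
    have rx y : y \in x0 :: t -> r x0 \in supp y.
      by move=> yt; apply: rP et _ yt; rewrite ?mem_head.
    have rsub x y : y \in x0 :: t -> supp x \subset supp y -> r x0 |: supp x \subset supp y.
      by move=> /rx ry xy; rewrite subUset sub1set ry.
    apply: (star_acyclic (v := r x0)).
    * exact: lt_le_trans de.
    * by apply: dK (bary_supp aK x0) _; rewrite sub1set rx ?mem_head.
    * move=> y yr; apply/hasP; exists x0; rewrite ?mem_head //.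
      by apply: subset_trans yr _; rewrite sub1set rx ?mem_head.
    * by move=> x /hasP[y yt xy]; apply: dK (bary_supp aK y) _; apply: rsub.
    * move=> x y /hasP[x1 x1t xx1] yx; apply/hasP; exists x1 => //.
      exact: subset_trans yx (rsub _ _ x1t xx1).
  + by move=> t u _ [_ eu]; split=> //; apply/allP.
  + move=> t et; have mt := vietoris_le em et.
    apply: supported_ext (cg t mt) _ => u [ut <-].
    apply: supported_sub (cf u (gsimp _ _ mt ut)) => w [[wu dw] szw]; split=> //.
    split; last by move=> x y v xw yw; apply: lt_le_trans de; apply: dw.
    apply/allP => x xw; have xu := allP wu x xw.
    have ut' : [set v in u] \subset verts t.
      by apply/subsetP => v; rewrite inE => /(mem_subseq ut); rewrite mem_enum.
    case: t ut' et {mt ut} => [u0|y t ut' et].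
      have [v /(subsetP xu) /(subsetP u0)] := supp_neq0 x.
      by rewrite inE.
    apply/hasP; exists y; rewrite ?mem_head //.
    apply: subset_trans (subset_trans xu ut') _.
    by apply: vertsS et _; rewrite ?mem_head.
  + move=> t et; apply: supportedU; split=> //; split; last exact: et.2.
    by apply/allP => x xt; apply/hasP; exists x.
  + by rewrite g0 extU f0.
  + exact: cfg.2.
  + by move=> s _; rewrite extU ext_id.
Qed.

End VietorisModel.

(** * Interleaving the scales of two systems of coordinates *)

Section EulerInvariance.
Variables (R : realType) (V W : finType) (X : choiceType).
Variables (K : {set {set V}}) (L : {set {set W}}) (a : X -> V -> R) (b : X -> W -> R).
Hypotheses (dK : down_closed K) (dL : down_closed L).
Hypotheses (K0 : set0 \in K) (L0 : set0 \in L).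
Hypotheses (aK : barycentric K a) (bL : barycentric L b).

Local Notation vieta d := (vietoris a d xpredT).
Local Notation vietb d := (vietoris b d xpredT).

Lemma euler_invariant :
  (forall e, 0 < e -> exists2 d, 0 < d & forall s, vieta d s -> vietb e s) ->
  (forall e, 0 < e -> exists2 d, 0 < d & forall s, vietb d s -> vieta e s) ->
  euler K = euler L.
Proof.
move=> ab ba.
have [fa [ga [fam gam gfa fga]]] := vietoris_model dK K0 aK.
have [fb [gb [fbm gbm gfb fgb]]] := vietoris_model dL L0 bL.
have below (Q : R -> Prop) m : 0 < m -> (forall d e, d <= e -> Q e -> Q d) ->
    (exists2 d, 0 < d & Q d) -> exists d, [/\ 0 < d, d <= m & Q d].
  move=> m0 Qle [d d0 Qd]; exists (Num.min d m).
  split; rewrite ?lt_min ?d0 ?ge_min ?lexx ?orbT //.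
  by apply: Qle Qd; rewrite ge_min lexx.
(* The scales are chosen from coarse to fine, giving nested complexes: [a] at [d] inside [b] at [e]
   inside [a] at [d1] inside [b] at its mesh. Each inclusion lets a map of one model be followed by
   a map of the other. *)
have [d1 [d1_gt0 d1m d1b]] := below (fun d => forall s, vieta d s -> vietb (mesh R W) s)
  _ (mesh_gt0 R V) (fun d e de h s ds => h s (vietoris_le de ds)) (ab _ (mesh_gt0 R W)).
have [e [e_gt0 em ed1]] := below (fun e => forall s, vietb e s -> vieta d1 s)
  _ (mesh_gt0 R W) (fun d e de h s ds => h s (vietoris_le de ds)) (ba _ d1_gt0).
have [d [d_gt0 dd1 de]] := below (fun d => forall s, vieta d s -> vietb e s)
  _ d1_gt0 (fun d e de h s ds => h s (vietoris_le de ds)) (ab _ e_gt0).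
have cfa := chain_map_subr de (fam d d_gt0).
have cga := chain_map_subl ed1 (gam d1 d1m).
have cfb := chain_map_subr ed1 (fbm e e_gt0).
have cgb := chain_map_subl d1b (gbm _ (lexx _)).
apply: (@euler_homotopy_invariant _ _ K L (fun s => ext gb (fa d s))
  (fun t => ext ga (fb e t)) dK dL).
- exact: chain_map_comp cfa (gbm e em).
- exact: chain_map_comp cfb (gam d1 d1m).
- have := homotopic_through cfa cga (fgb e e e_gt0 (lexx _) em)
    (gfa d d_gt0 (le_trans dd1 d1m)).
  congr homotopic; apply/funext => s.
  by rewrite -(ext_ext ga (fb e)) -(ext_ext (fb e) gb).
(* Here the detour is made on the coarse complex at [d1] by a map reaching the finer scale [d]: the
   two-scale homotopy is used in full. *)
- have := homotopic_through cfb cgb (fga d d1 d_gt0 dd1 d1m) (gfb e e_gt0 em).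
  congr homotopic; apply/funext => s.
  by rewrite -(ext_ext gb (fa d)) -(ext_ext (fa d) ga).
Qed.

End EulerInvariance.

(** * Spheres and cross-polytopes *)

Section CompactSeparation.
Local Open Scope classical_set_scope.

Lemma compact_set_type (T : topologicalType) (A : set T) :
  compact A -> compact [set: classical_sets.set_type A].
Proof.
move=> cA F FF _.
have [p [Ap clp]] : A `&` cluster (set_val @ F) !=set0.
  apply: cA; suff : F (set_val @^-1` A) by [].
  by apply: filterS filterT => x _; apply: (set_mem (valP x)).
exists (SigSub (mem_set Ap)); split=> // B U FB.
rewrite nbhsE => -[U' [[V oV VU'] U'p] U'U].
have /clp clB : (set_val @ F) (set_val @` B).
  suff : F (set_val @^-1` (set_val @` B)) by [].
  by apply: filterS FB => x Bx; exists x.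
have [|_ [[x Bx <-] Vx]] := clB V.
  by apply: open_nbhs_nbhs; split=> //; move: U'p; rewrite -VU'.
by exists x; split=> //; apply: U'U; rewrite -VU'.
Qed.

(** Uniform continuity of [q] measured by [p]. Otherwise pairs ever closer for [p] yet [e]-apart for
    [q] would cluster, by compactness of the square, at a pair that [p] does not separate, that is
    at a diagonal point, against the continuity of [q]. *)
Lemma compact_separating (R : realType) (V W : finType) (X : topologicalType)
    (p : V -> X -> R) (q : W -> X -> R) : compact [set: X] ->
  (forall v, continuous (p v)) -> (forall w, continuous (q w)) ->
  (forall x y, (forall v, p v x = p v y) -> x = y) ->
  forall e : R, 0 < e -> exists2 d : R, 0 < d &
    forall x y, (forall v, `|p v x - p v y| < d) -> forall w, `|q w x - q w y| < e.
Proof.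
move=> cX cp cq inj e e0; apply: contrapT => H.
pose E (d : R) : set (X * X) := [set z | (forall v, `|p v z.1 - p v z.2| < d) /\
  exists w, e <= `|q w z.1 - q w z.2|].
pose F : set_system (X * X) := filter_from [set d : R | 0 < d] E.
have FF : ProperFilter F.
  apply: filter_from_proper; last first.
    move=> d /= d0; apply: contrapT => Ed; apply: H; exists d => // x y xy w.
    rewrite ltNge; apply/negP => exy; apply: Ed; exists (x, y); split=> //.
    by exists w.
  apply: filter_from_filter; first by exists 1; rewrite /= ltr01.
  move=> d1 d2 /= d10 d20; exists (Num.min d1 d2); first by rewrite /= lt_min d10.
  move=> z [zd [w zw]]; split; (split; last by exists w) => v.
    by apply: lt_le_trans (zd v) _; rewrite ge_min lexx.
  by apply: lt_le_trans (zd v) _; rewrite ge_min lexx orbT.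
have [|[x y] [_ clxy]] := compact_setX cX cX FF.
  by apply: filterS filterT.
have near_coord (I : finType) (f : I -> X -> R) (h : R) : (forall i, continuous (f i)) ->
    0 < h -> \forall z \near (x, y),
    forall i, `|f i x - f i z.1| < h /\ `|f i y - f i z.2| < h.
  move=> cf h0; apply: (@filter_forall _ _ _ (nbhs (x, y))) => i; apply: filterI.
    have /cvgrPdist_lt : f i z.1 @[z --> (x, y)] --> f i x.
      by apply: (@cvg_comp _ _ _ fst (f i) _ (nbhs x)); [exact: cvg_fst|exact: cf].
    by apply.
  have /cvgrPdist_lt : f i z.2 @[z --> (x, y)] --> f i y.
    by apply: (@cvg_comp _ _ _ snd (f i) _ (nbhs y)); [exact: cvg_snd|exact: cf].
  by apply.
have FE (d : R) : 0 < d -> F (E d) by move=> d0; exists d.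
have exy : x = y.
  apply: inj => v; apply/eqP; rewrite -subr_eq0 -normr_le0 leNgt; apply/negP => pxy.
  (* A third, because the way from [x] to [y] goes through both components of [z]. *)
  have d0 : 0 < `|p v x - p v y| / 3 by rewrite divr_gt0.
  have [z [[zd _] zp]] := clxy _ _ (FE _ d0) (near_coord _ _ _ cp d0).
  have [zx zy] := zp v; move: (zd v) zx zy pxy; rewrite !ltr_norml.
  by case: (ger0P (p v x - p v y)) => _ /andP[? ?] /andP[? ?] /andP[? ?] ?; lra.
have e20 : 0 < e / 2 by rewrite divr_gt0.
have [z [[_ [w zw]] zq]] := clxy _ _ (FE 1 ltr01) (near_coord _ _ _ cq e20).
have [zx zy] := zq w; move: zw zx zy; rewrite -exy !ltr_norml ler_normr.
by case/orP => h /andP[h1 h2] /andP[h3 h4]; lra.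
Qed.

End CompactSeparation.

(** The boundary complex: [(i, true)] and [(i, false)] are opposite vertices on axis [i], never in a
    common face. For [n = 0] only the empty face remains, in agreement with the empty sphere. *)
Definition crosspolytope (n : nat) : {set {set 'I_n * bool}} :=
  [set A : {set 'I_n * bool} | [forall i, ((i, true) \in A) ==> ((i, false) \notin A)]].

Lemma down_closed_crosspolytope n : down_closed (crosspolytope n).
Proof.
move=> A B; rewrite !inE => /forallP AP /subsetP BA; apply/forallP => i.
apply/implyP => /BA iA; apply: contraNN (implyP (AP i) iA); exact: BA.
Qed.

Lemma set0_crosspolytope n : set0 \in crosspolytope n.
Proof. by rewrite inE; apply/forallP => i; rewrite !inE. Qed.

(* A simplex picks, for each coordinate, a sign or nothing. *)
Lemma euler_crosspolytope n : euler (crosspolytope n) = (-1) ^+ n.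
Proof.
pose simp (f : {ffun 'I_n -> option bool}) : {set 'I_n * bool} :=
  [set p | f p.1 == Some p.2].
pose signs (A : {set 'I_n * bool}) : {ffun 'I_n -> option bool} :=
  [ffun i => if (i, true) \in A then Some true
             else if (i, false) \in A then Some false else None].
have signsK : {in crosspolytope n, cancel signs simp}.
  move=> A; rewrite inE => /forallP AP; apply/setP => -[i b]; rewrite inE ffunE /=.
  have := AP i; case: b; do 2![case: (_ \in A)] => //.
have simpK f : signs (simp f) = f.
  apply/ffunP => i; rewrite ffunE !inE /=.
  by case: (f i) => [[]|] //.
have simpP f : simp f \in crosspolytope n.
  by rewrite inE; apply/forallP => i; rewrite !inE /=; case: (f i) => [[]|].
rewrite /euler (reindex_onto simp signs) //=.
transitivity (\sum_(f : {ffun 'I_n -> option bool}) \prod_i (-1) ^+ (f i != None) : int).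
  apply: eq_big => [f|f _]; first by rewrite simpP simpK eqxx.
  rewrite prodrXr; congr (_ ^+ _).
  rewrite -sum1_card (partition_big fst xpredT) //=; apply: eq_bigr => i _.
  case fi: (f i) => [b|] /=.
    rewrite (big_pred1 (i, b)) // => -[j c] /=; rewrite inE /= xpair_eqE andbC.
    by case: (j =P i) => //= ->; rewrite fi eq_sym.
  by rewrite big_pred0 // => -[j c]; rewrite inE /=; case: (j =P i) => [->|]; rewrite ?fi ?andbF.
(* Each axis contributes 1 for no vertex and -1 for either sign, in all -1. *)
rewrite -(bigA_distr_bigA (fun _ (o : option bool) => (-1) ^+ (o != None))).
rewrite (eq_bigr (fun _ => -1)) ?prodr_const ?card_ord // => i _.
rewrite (bigD1 None) //= (bigD1 (Some true)) //= (bigD1 (Some false)) //= big1 //.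
by case=> [[]|].
Qed.

Lemma continuous_sum (R : realType) (T : topologicalType) (I : finType)
    (f : I -> T -> R) :
  (forall i, continuous (f i)) -> continuous (fun x => \sum_i f i x).
Proof. by move=> cf; apply: continuous_big => //; apply: add_continuous. Qed.

(** * Radial projection of the round sphere onto the cross-polytope *)

Section SphereCrosspolytope.
Variables (R : realType) (n : nat).
Local Open Scope classical_set_scope.

Local Notation sphere := (classical_sets.set_type (unit_sphere R n)).

Definition sphere_coord (i : 'I_n) (x : sphere) : R := \val x ord0 i.

Lemma sphere_coordP x : \sum_i sphere_coord i x ^+ 2 = 1.
Proof. exact: (set_mem (valP x)). Qed.

Lemma sphere_coord_inj x y : (forall i, sphere_coord i x = sphere_coord i y) -> x = y.
Proof. by move=> xy; apply/val_inj/rowP => i; apply: xy. Qed.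

Lemma sphere_coord_continuous i : continuous (sphere_coord i).
Proof.
move=> x; apply: (@continuous_comp _ _ _ set_val (fun v : 'rV[R]_n => v ord0 i)).
  exact: initial_continuous.
exact: coord_continuous.
Qed.

Lemma sphere_compact : compact [set: sphere].
Proof.
apply: compact_set_type; apply: bounded_closed_compact.
  exists 1; split=> // M M1 x /= xS.
  rewrite /Num.norm /= mx_normrE; apply: bigmax_le => [|[i j] _ /=].
    by rewrite ltW // (lt_trans ltr01).
  rewrite (ord1 i); apply: le_trans (ltW M1).
  rewrite -(ler_pXn2r (ltn0Sn 1)) ?nnegrE // expr1n real_normK ?num_real // -xS.
  by rewrite (bigD1 j) //= lerDl sumr_ge0 // => k _; apply: sqr_ge0.
apply: (preimage_closed _ (@closed_eq R 1)) => x _.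
apply: continuous_sum => i y; have cy := @coord_continuous R 1 n ord0 i y.
exact: (cvgM cy cy).
Qed.

Definition l1norm (x : sphere) : R := \sum_i `|sphere_coord i x|.

Lemma l1norm_gt0 x : 0 < l1norm x.
Proof.
rewrite lt_def sumr_ge0 ?andbT; last by move=> i _; apply: normr_ge0.
apply/eqP => /psumr_eq0P x0; have := sphere_coordP x.
rewrite big1 => [/eqP|i _]; first by rewrite eq_sym oner_eq0.
have /eqP : `|sphere_coord i x| = 0 by apply: x0.
by rewrite normr_eq0 => /eqP ->; rewrite expr0n.
Qed.

(* The positive part for b = true, the negative part for b = false. *)
Definition signed_part (r : R) (b : bool) : R := (`|r| + (if b then r else - r)) / 2.

(** The barycentric coordinates of the radial projection of [x] to the unit sphere of the l1
    norm. *)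
Definition cross_coord (x : sphere) (p : 'I_n * bool) : R :=
  signed_part (sphere_coord p.1 x) p.2 / l1norm x.

Lemma signed_part_ge0 r b : 0 <= signed_part r b.
Proof. by rewrite /signed_part; case: b; case: (ger0P r) => h; lra. Qed.

Lemma signed_partB r : signed_part r true - signed_part r false = r.
Proof. by rewrite /signed_part; lra. Qed.

Lemma signed_partD r : signed_part r true + signed_part r false = `|r|.
Proof. by rewrite /signed_part; lra. Qed.

Lemma signed_part_eq0 r : signed_part r true = 0 \/ signed_part r false = 0.
Proof.
by rewrite /signed_part; case: (ger0P r) => h; [right|left]; lra.
Qed.

Lemma signed_partM r c b : 0 <= c -> signed_part (r * c) b = signed_part r b * c.
Proof.
by move=> c0; rewrite /signed_part normrM (ger0_norm c0); case: b; lra.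
Qed.

Lemma cross_coord_continuous p : continuous (cross_coord^~ p).
Proof.
move=> x; have cc i : sphere_coord i y @[y --> x] --> sphere_coord i x.
  exact: sphere_coord_continuous.
have cl : l1norm y @[y --> x] --> l1norm x.
  apply: (@continuous_sum R _ _ (fun i y => `|sphere_coord i y|)) => i y.
  exact: (cvg_norm (@sphere_coord_continuous i y)).
have cs : (if p.2 then sphere_coord p.1 y else - sphere_coord p.1 y) @[y --> x] -->
    (if p.2 then sphere_coord p.1 x else - sphere_coord p.1 x).
  by case: p.2; [exact: (cc p.1)|exact: (cvgN (cc p.1))].
have l0 : l1norm x != 0 by rewrite gt_eqF // l1norm_gt0.
exact: (cvgM (cvgM (cvgD (cvg_norm (cc p.1)) cs) (cvg_cst _)) (cvgV l0 cl)).
Qed.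

Lemma sum_pair (f : 'I_n * bool -> R) : \sum_p f p = \sum_i (f (i, true) + f (i, false)).
Proof.
transitivity (\sum_i \sum_b f (i, b)); last by apply: eq_bigr => i _; rewrite big_bool.
by rewrite pair_bigA; apply: eq_bigr => -[].
Qed.

Lemma cross_coord_barycentric : barycentric (crosspolytope n) cross_coord.
Proof.
split.
- by move=> x p; rewrite divr_ge0 ?signed_part_ge0 // ltW // l1norm_gt0.
- move=> x; rewrite sum_pair -[RHS](divff (lt0r_neq0 (l1norm_gt0 x))) mulr_suml.
  by apply: eq_bigr => i _; rewrite /cross_coord -mulrDl signed_partD.
- move=> x; rewrite inE; apply/forallP => i; rewrite !inE /cross_coord /=.
  by case: (signed_part_eq0 (sphere_coord i x)) => ->; rewrite mul0r eqxx ?implybT.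
- move=> x y xy.
  have e i : sphere_coord i x / l1norm x = sphere_coord i y / l1norm y.
    have := xy (i, true); have := xy (i, false); rewrite /cross_coord /= => e1 e2.
    by rewrite -(signed_partB (sphere_coord i x)) -[in RHS](signed_partB (sphere_coord i y))
      !mulrBl e1 e2.
  have x0 := l1norm_gt0 x; have y0 := l1norm_gt0 y.
  (* The Euclidean norm is 1, so the squares of the projected coordinates sum to the inverse square
     of the l1 norm; the projection thus determines the scaling factor. *)
  have nxy : l1norm x ^- 2 = l1norm y ^- 2.
    have h z : l1norm z ^- 2 = \sum_i (sphere_coord i z / l1norm z) ^+ 2.
      under eq_bigr do rewrite exprMn exprVn.
      by rewrite -mulr_suml sphere_coordP mul1r.
    by rewrite !h; apply: eq_bigr => i _; rewrite e.
  have {}nxy : l1norm x = l1norm y.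
    apply/eqP; rewrite -(eqrXn2 (ltn0Sn 1)) ?ltW //.
    by apply/eqP/invr_inj.
  apply: sphere_coord_inj => i; have := e i; rewrite nxy.
  by apply: mulIf; rewrite invr_eq0 gt_eqF.
- move=> p p0 p1 pK.
  (* The inverse projection: signed coordinates are read off from [p] and rescaled to Euclidean norm
     1. *)
  pose u i := p (i, true) - p (i, false).
  have pz i : p (i, true) = 0 \/ p (i, false) = 0.
    move: pK; rewrite inE => /forallP/(_ i); rewrite !inE.
    by case: eqP => [|_ /=]; [left|rewrite negbK => /eqP; right].
  have up i b : signed_part (u i) b = p (i, b).
    rewrite /signed_part /u; have := p0 (i, true); have := p0 (i, false).
    case: b; case: (pz i) => ->; rewrite ?sub0r ?subr0 ?normrN => h1 h2;
      rewrite ger0_norm //; lra.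
  have un i : `|u i| = p (i, true) + p (i, false) by rewrite -signed_partD !up.
  pose r := Num.sqrt (\sum_i u i ^+ 2).
  have r2 : r ^+ 2 = \sum_i u i ^+ 2 by rewrite sqr_sqrtr ?sumr_ge0 // => i _; apply: sqr_ge0.
  have r0 : 0 < r.
    rewrite lt_def sqrtr_ge0 andbT -sqrf_eq0 r2; apply/eqP => /psumr_eq0P u0.
    have := p1; rewrite sum_pair big1 => [/eqP|i _]; first by rewrite eq_sym oner_eq0.
    rewrite -un; apply/eqP; rewrite normr_eq0 -sqrf_eq0; apply/eqP/u0 => // j _.
    exact: sqr_ge0.
  have xS : unit_sphere R n (\row_i (u i / r)).
    rewrite /unit_sphere /=; under eq_bigr do rewrite mxE exprMn exprVn.
    by rewrite -mulr_suml -r2 divff // sqrf_eq0 gt_eqF.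
  exists (SigSub (mem_set xS)) => -[i b].
  have xi j : sphere_coord j (SigSub (mem_set xS)) = u j / r by rewrite /sphere_coord /= mxE.
  have -> : cross_coord (SigSub (mem_set xS)) (i, b) = p (i, b) / r / r^-1.
    rewrite /cross_coord /= xi signed_partM ?up ?invr_ge0 ?ltW //.
    congr (_ / _); rewrite /l1norm.
    under eq_bigr do rewrite xi normrM un normfV (ger0_norm (ltW r0)).
    by rewrite -mulr_suml -sum_pair p1 mul1r.
  by rewrite mulfK // invr_eq0 gt_eqF.
Qed.

End SphereCrosspolytope.

(** The common point set is the sphere, with the coordinates of [K] pulled back along [g] and those
    of the cross-polytope. Both are continuous and injective on a compact space, so each controls
    the other uniformly. *)
Theorem euler_sphere (R : realType) (d : Order.disp_t) (P : finPOrderType d)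
    (K : {set {set P}}) (n : nat) : down_closed K -> set0 \in K ->
  homeomorphic (classical_sets.set_type (realization R K))
    (classical_sets.set_type (unit_sphere R n)) ->
  euler K = (-1) ^+ n.
Proof.
move=> dK K0 [f [g [cf cg fK gK]]].
pose a (x : classical_sets.set_type (unit_sphere R n)) (v : P) : R := (\val (g x) : P -> R) v.
have gP x : realization R K (\val (g x)) by apply: (set_mem (valP (g x))).
have aK : barycentric K a.
  split.
  - by move=> x v; have [h _ _] := gP x; exact: h.
  - by move=> x; have [_ h _] := gP x; exact: h.
  - by move=> x; have [_ _ h] := gP x; exact: h.
  - move=> x y xy; apply: (can_inj gK); apply: val_inj; exact/funext.
  - move=> p p0 p1 pK.
    have pr : realization R K p by split.
    by exists (f (SigSub (mem_set pr))) => v; rewrite /a fK.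
have ca v : continuous (a^~ v).
  move=> x; apply: (@continuous_comp _ _ _ g (fun z => (\val z : P -> R) v)); first exact: cg.
  apply: (@continuous_comp _ _ _ set_val (fun z : {ptws P -> R} => z v)).
    exact: initial_continuous.
  exact: (@proj_continuous _ (fun=> R) v).
have bL := cross_coord_barycentric R n.
rewrite -(euler_crosspolytope n).
have cS := @sphere_compact R n.
have unif (V W : finType) (p : classical_sets.set_type (unit_sphere R n) -> V -> R)
    (q : classical_sets.set_type (unit_sphere R n) -> W -> R) :
  (forall v, continuous (p^~ v)) -> (forall w, continuous (q^~ w)) ->
  (forall x y, p x =1 p y -> x = y) ->
  forall e : R, 0 < e -> exists2 d : R, 0 < d &
    forall s, vietoris p d xpredT s -> vietoris q e xpredT s.
  move=> cp cq pinj e e0.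
  have [h h0 hP] := compact_separating cS cp cq (pinj) e0.
  exists h => // s [_ ps]; split=> [|x y w xs ys]; first exact/allP.
  by apply: hP => v; apply: ps.
apply: (euler_invariant dK (@down_closed_crosspolytope n) K0 (set0_crosspolytope n) aK bL).
  by apply: unif => //; [exact: cross_coord_continuous | exact: (bary_inj aK)].
by apply: unif => //; [exact: cross_coord_continuous | exact: (bary_inj bL)].
Qed.

(** * Chains, ranks and Moebius inversion *)

Section ChainEuler.
Context {d : Order.disp_t} {P : finPOrderType d}.
Implicit Types (A s t : {set P}) (p q x y : P).

Lemma down_closed_order_complex A : down_closed (order_complex A).
Proof.
move=> s t; rewrite !inE => /andP[sA /forall_inP cs] ts.
rewrite (subset_trans ts sA); apply/forall_inP => x xt; apply/forall_inP => y yt.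
by have /forall_inP := cs _ (subsetP ts _ xt); apply; apply: (subsetP ts).
Qed.

Lemma set0_order_complex A : set0 \in order_complex A.
Proof. by rewrite inE sub0set; apply/forall_inP => x; rewrite inE. Qed.

Lemma chainP s : reflect (forall x y, x \in s -> y \in s -> (x >=< y)%O) (chain s).
Proof.
apply: (iffP forall_inP) => [cs x y xs ys|cs x xs].
  exact: (forall_inP (cs x xs) y ys).
by apply/forall_inP => y; apply: cs.
Qed.

Lemma order_complexP A s :
  reflect (s \subset A /\ forall x y, x \in s -> y \in s -> (x >=< y)%O)
  (s \in order_complex A).
Proof. by rewrite inE; apply: (iffP andP) => -[sA /chainP cs]. Qed.

Lemma order_complexU1 A s p : (forall q, q \in s -> (q <= p)%O) ->
  p \in A -> s \in order_complex A -> p |: s \in order_complex A.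
Proof.
move=> sp pA /order_complexP[sA cs]; apply/order_complexP; split.
  by rewrite subUset sub1set pA.
move=> x y; rewrite !inE => /predU1P[->|xs] /predU1P[->|ys].
- exact: comparablexx.
- by rewrite comparable_sym le_comparable // sp.
- by rewrite le_comparable // sp.
- exact: cs.
Qed.

(* Pairing s with its symmetric difference with the apex p. *)
Lemma euler_cone A p : p \in A -> (forall q, q \in A -> (q <= p)%O) ->
  euler (order_complex A) = 0.
Proof.
move=> pA Ap; rewrite /euler (bigID (fun s : {set P} => p \in s)) /=.
rewrite (reindex_onto (fun s => p |: s) (fun s => s :\ p)) /=; last first.
  by move=> s /andP[_ ps]; rewrite setD1K.
rewrite -[X in _ + X]opprK; apply/eqP; rewrite subr_eq0; apply/eqP.
rewrite -sumrN; apply: eq_big => [s|s].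
  rewrite setU11 andbT; apply/andP/andP => [[ps /eqP sE]|[sA ps]]; last first.
    rewrite setU1K // eqxx; split=> //; apply: order_complexU1 => // q qs.
    by move: sA; rewrite inE => /andP[/subsetP sA _]; apply/Ap/sA.
  split; last by rewrite -sE !inE eqxx.
  by apply: down_closed_order_complex ps _; apply: subsetUr.
case/andP=> _ /eqP sE; have ps : p \notin s by rewrite -sE !inE eqxx.
by rewrite cardsU1 ps exprS mulN1r.
Qed.

(* Sort the nonempty chains by their largest element. *)
Lemma euler_down A : euler (order_complex A) =
  1 - \sum_(q in A) euler (order_complex (down_lt A q)).
Proof.
pose top (s : {set P}) : option P := [pick q in s | [forall r in s, (r <= q)%O]].
have topP s q : top s = Some q <-> q \in s /\ forall r, r \in s -> (r <= q)%O.
  rewrite /top; case: pickP => [q' /andP[q's /forall_inP q'P]|no]; split=> //.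
  - by case=> <-.
  - by case=> qs qP; congr Some; apply/le_anti; rewrite q'P // qP.
  - by case=> qs qP; have := no q; rewrite qs /= => /negP[]; apply/forall_inP.
rewrite /euler (bigD1 set0) ?set0_order_complex //= cards0 expr0; congr (_ + _).
rewrite (partition_big top (fun o => if o is Some q then q \in A else false)) /=; last first.
  move=> s /andP[/order_complexP[sA cs] s0].
  (* In a finite chain, the element with the most members of [s] below it is the largest. *)
  pose f p := #|[set q in s | (q <= p)%O]|.
  have [p0 p0s] := set0Pn _ s0.
  case: (arg_maxnP f p0s) => p ps pmax.
  have -> : top s = Some p.
    apply/topP; split=> // q qs; have /orP[//|pq] := cs q p qs ps.
    have := pmax q qs; rewrite /f => fqp.
    have sub : [set r in s | (r <= p)%O] \subset [set r in s | (r <= q)%O].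
      by apply/subsetP => r; rewrite !inE => /andP[-> /le_trans ->].
    have /setP/(_ q) : [set r in s | (r <= p)%O] = [set r in s | (r <= q)%O].
      by apply/eqP; rewrite eqEcard sub.
    by rewrite !inE qs lexx.
  exact: (subsetP sA).
rewrite (reindex_omap Some id) /=; last by case.
rewrite -sumrN; apply: eq_big => [q|q qA]; first by rewrite eqxx andbT.
rewrite -sumrN.
rewrite (reindex_onto (fun s => q |: s) (fun s => s :\ q)) /=; last first.
  move=> s /andP[_ /eqP/topP[qs _]]; exact: setD1K.
apply: eq_big => [s|s].
  apply/andP/idP => [[/andP[/andP[sA _] /eqP/topP[_ qP]] /eqP sE]|/order_complexP[sA cs]].
    apply/order_complexP; have /order_complexP[sA' cs] := sA; split; last first.
      by move=> x y xs ys; apply: cs; rewrite inE ?xs ?ys orbT.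
    apply/subsetP => r rs; have rs' : r \in q |: s by rewrite inE rs orbT.
    rewrite inE (subsetP sA') //= lt_neqAle qP // andbT.
    by move: rs; rewrite -sE !inE => /andP[].
  have qs : q \notin s by apply/negP => /(subsetP sA); rewrite !inE ltxx andbF.
  have sq r : r \in s -> (r < q)%O by move=> /(subsetP sA); rewrite inE => /andP[].
  have sA' : s \subset A.
    by apply/subsetP => r /(subsetP sA); rewrite inE => /andP[].
  rewrite setU1K ?eqxx //; split=> //; apply/andP; split.
    rewrite order_complexU1 ?andTb //; first by apply/set0Pn; exists q; rewrite setU11.
      by move=> r /sq/ltW.
      by case/andP: qA.
    by apply/order_complexP.
  apply/eqP/topP; rewrite setU11; split=> // r.
  by rewrite in_setU1 => /predU1P[->|/sq/ltW].
case/andP=> _ /eqP sE; have qs : q \notin s by rewrite -sE !inE eqxx.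
by rewrite cardsU1 qs exprS mulN1r.
Qed.

Lemma sum_euler_down A p : p \in A -> (forall q, q \in A -> (q <= p)%O) ->
  \sum_(q in A) euler (order_complex (down_lt A q)) = 1.
Proof.
move=> pA Ap; have := euler_down A; rewrite (euler_cone pA Ap) => /eqP.
by rewrite eq_sym subr_eq0 => /eqP.
Qed.

End ChainEuler.

(** * Ranks in graded posets *)

Section Rank.
Context {d : Order.disp_t} {P : finPOrderType d}.
Implicit Types (A s t : {set P}) (p q c x y : P).

(** The dimension of the cell [p]; the sphere that bounds it in a CW poset is the unit sphere of R^n
    with n = [rank A p]. *)
Definition rank A p := complex_dim (order_complex (down_le A p)).

Lemma graded_rank A p s : graded A -> p \in A ->
  maxset (mem (order_complex (down_le A p))) s -> #|s| = (rank A p).+1.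
Proof.
move=> gA pA smax; pose K := order_complex (down_le A p).
have Kp : [set p] \in K.
  apply/order_complexP; split; first by rewrite sub1set inE pA lexx.
  by move=> x y /set1P-> /set1P->; apply: comparablexx.
case: (arg_maxnP (fun t : {set P} => #|t|) Kp) => t Kt tmax.
have tmaxset : maxset (mem K) t.
  apply/maxsetP; split=> // u Ku tu; apply/esym/eqP.
  by rewrite eqEcard tu; apply: tmax.
rewrite (gA p pA _ _ smax tmaxset) /rank /complex_dim.
have -> : \max_(u in K) #|u| = #|t|.
  apply/eqP; rewrite eqn_leq; apply/andP; split; first by apply/bigmax_leqP.
  exact: leq_bigmax_cond.
by rewrite prednK //; have := tmax _ Kp; rewrite cards1.
Qed.

Lemma maxset_chain_mem A s t x : maxset (mem (order_complex A)) s ->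
  x \in A -> t \in order_complex A -> s \subset t -> (forall y, y \in t -> (x >=< y)%O) ->
  x \in s.
Proof.
move=> /maxsetP[_ smax] xA /order_complexP[tA ct] st xt.
rewrite -(smax (x |: t)) ?setU11 //; last by rewrite subsetU // st orbT.
apply/order_complexP; split; first by rewrite subUset sub1set xA.
move=> y z; rewrite !in_setU1 => /predU1P[->|yt] /predU1P[->|zt].
- exact: comparablexx.
- exact: xt.
- by rewrite comparable_sym xt.
- exact: ct.
Qed.

(* Splice a maximal chain below c with a maximal chain of A' through c. *)
Lemma rank_add A A' c p : graded A -> graded A' -> A' \subset A ->
  c \in A' -> p \in A' -> (c <= p)%O -> (forall q, q \in A -> (c <= q)%O -> q \in A') ->
  (forall q, q \in A' -> (q <= c)%O -> q = c) ->
  rank A p = (rank A c + rank A' p)%N.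
Proof.
move=> gA gA' /subsetP AA' cA' pA' cp upA' minc.
have cA := AA' _ cA'; have pA := AA' _ pA'.
have K1 : [set c] \in order_complex (down_le A c).
  apply/order_complexP; split; first by rewrite sub1set inE cA lexx.
  by move=> x y /set1P-> /set1P->; apply: comparablexx.
have K2 : [set c] \in order_complex (down_le A' p).
  apply/order_complexP; split; first by rewrite sub1set inE cA'.
  by move=> x y /set1P-> /set1P->; apply: comparablexx.
have [s1 m1 cs1] := maxset_exists K1; have [s2 m2 cs2] := maxset_exists K2.
rewrite sub1set in cs1; rewrite sub1set in cs2.
have [k1 _] := maxsetP m1; have [k2 _] := maxsetP m2.
have /order_complexP[/subsetP s1A c1] := k1; have /order_complexP[/subsetP s2A c2] := k2.
have s1c x : x \in s1 -> (x <= c)%O by move=> /s1A; rewrite inE => /andP[].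
have s2c x : x \in s2 -> (c <= x)%O.
  move=> xs2; have /orP[//|xc] := c2 c x cs2 xs2.
  by have := s2A x xs2; rewrite inE => /andP[xA' _]; rewrite (minc x).
have U : s1 :|: s2 \in order_complex (down_le A p).
  apply/order_complexP; split.
    apply/subsetP => x; rewrite in_setU => /orP[xs|xs].
      by have := s1A x xs; rewrite !inE => /andP[-> /le_trans ->].
    by have := s2A x xs; rewrite !inE => /andP[/AA' -> ->].
  move=> x y; rewrite !in_setU => /orP[xs|xs] /orP[ys|ys].
  - exact: c1.
  - by rewrite le_comparable // (le_trans (s1c x xs)) ?s2c.
  - by rewrite comparable_sym le_comparable // (le_trans (s1c y ys)) ?s2c.
  - exact: c2.
have Umax : maxset (mem (order_complex (down_le A p))) (s1 :|: s2).
  apply/maxsetP; split=> // t kt Ut; apply/eqP; rewrite eqEsubset Ut andbT.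
  have /order_complexP[/subsetP tA ct] := kt.
  have s1t x : x \in s1 -> x \in t by move=> xs; apply: (subsetP Ut); rewrite inE xs.
  have s2t x : x \in s2 -> x \in t by move=> xs; apply: (subsetP Ut); rewrite inE xs orbT.
  apply/subsetP => x xt; have := tA x xt; rewrite !inE => /andP[xA xp].
  have /orP[xc|cx] := ct x c xt (s1t c cs1).
    rewrite (maxset_chain_mem m1 (t := s1)) //; first by rewrite inE xA xc.
    by move=> y /s1t yt; apply: ct.
  rewrite (maxset_chain_mem m2 (t := s2)) ?orbT //; first by rewrite inE upA'.
  by move=> y /s2t yt; apply: ct.
(* The shared element [c] absorbs the shift between size and rank: (r + 1) + 1 = (r1 + 1) + (r2 +
   1). *)
have I : s1 :&: s2 = [set c].
  apply/setP => x; rewrite !inE; apply/andP/eqP => [[/s1c xc /s2c cx]|->] //.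
  by apply/le_anti; rewrite xc.
have := cardsUI s1 s2; rewrite I cards1 (graded_rank gA pA Umax).
by rewrite (graded_rank gA cA m1) (graded_rank gA' pA' m2) addn1 addSn addnS => -[].
Qed.

End Rank.

(** * Moebius inversion on intervals and principal ideals *)

Section MobiusInversion.
Context {d : Order.disp_t} {P : finPOrderType d}.
Implicit Types x y z : P.

Lemma mobius_ge x y : mobius x y != 0 -> (x <= y)%O.
Proof.
rewrite mobiusE; case: (x =P y) => [-> _|_]; first exact: lexx.
by case: ifP => [/ltW|]; rewrite ?eqxx.
Qed.

Lemma sum_mobius x y : (x <= y)%O -> \sum_(z | (x <= z <= y)%O) mobius x z = (x == y)%:R.
Proof.
move=> xy; rewrite (bigD1 y) ?xy ?lexx //= mobiusE.
have eqr : \sum_(i | (x <= i <= y)%O && (i != y)) mobius x i =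
    \sum_(z | (x <= z < y)%O) mobius x z.
  by apply: eq_bigl => z; rewrite lt_neqAle -andbA; congr (_ && _); rewrite andbC.
rewrite eqr; case: eqP => [->|/eqP nxy].
  rewrite big1 ?addr0 // => z /andP[yz /(le_lt_trans yz)]; rewrite ltxx.
  by [].
by rewrite lt_neqAle nxy xy addNr.
Qed.

(* The matrix of mu is a one-sided, hence two-sided, inverse of that of zeta. *)
Lemma sum_mobius_dual x y : (x <= y)%O ->
  \sum_(z | (x <= z <= y)%O) mobius z y = (x == y)%:R.
Proof.
move=> xy; pose n := #|P|.
pose M : 'M[int]_n := \matrix_(i, j) mobius (enum_val i) (enum_val j).
pose Z : 'M[int]_n := \matrix_(i, j) ((enum_val i <= enum_val j)%O)%:R.
have sumE (F : P -> int) : \sum_(k < n) F (enum_val k) = \sum_z F z.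
  by rewrite -(big_enum_val F); apply: eq_bigl => z.
have MZ : M *m Z = 1%:M.
  apply/matrixP => i j; rewrite !mxE.
  rewrite (eq_bigr (fun k => mobius (enum_val i) (enum_val k) *
      ((enum_val k <= enum_val j)%O)%:R)); last by move=> k _; rewrite !mxE.
  rewrite (sumE (fun z => mobius (enum_val i) z * ((z <= enum_val j)%O)%:R)) /=.
  have [ij|nij] := boolP (enum_val i <= enum_val j)%O.
    rewrite -(inj_eq enum_val_inj) -(sum_mobius ij) big_mkcond [RHS]big_mkcond /=.
    apply: eq_bigr => z _; case: (boolP (z <= _)%O) => zj; rewrite ?andbT ?andbF ?mulr0 //.
    rewrite mulr1; case: ifP => // /negbT niz; apply/eqP; apply: contraNT niz.
    exact: mobius_ge.
  rewrite big1 => [|z _].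
    by case: eqP nij => // ->; rewrite lexx.
  have [->|/mobius_ge iz] := eqVneq (mobius (enum_val i) z) 0; first by rewrite mul0r.
  case: (boolP (z <= _)%O) => [zj|]; last by rewrite mulr0.
  by rewrite (le_trans iz zj) in nij.
have /matrixP/(_ (enum_rank x) (enum_rank y)) := mulmx1C MZ.
rewrite !mxE (inj_eq enum_rank_inj) => <-.
rewrite (eq_bigr (fun k => ((x <= enum_val k)%O)%:R * mobius (enum_val k) y)); last first.
  by move=> k _; rewrite !mxE !enum_rankK.
rewrite (sumE (fun z => ((x <= z)%O)%:R * mobius z y)) /=.
rewrite big_mkcond; apply: eq_bigr => z _.
case: (boolP (x <= z)%O) => xz; rewrite /= ?mul0r // mul1r.
case: ifP => // /negbT nzy; apply/esym/eqP; apply: contraNT nzy; exact: mobius_ge.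
Qed.

(** The relation is assumed only between [x] and [y], because the counts it is applied to satisfy it
    only below the support of a fixed cell. *)
Lemma mobius_inversion_up (F G : P -> int) x y :
  (forall z, (x <= z <= y)%O -> G z = \sum_(w | (z <= w <= y)%O) F w) -> (x <= y)%O ->
  F x = \sum_(z | (x <= z <= y)%O) mobius x z * G z.
Proof.
move=> GF xy; under eq_bigr => z xzy do rewrite GF // mulr_sumr.
rewrite (exchange_big_dep (fun w => (x <= w <= y)%O)) /=; last first.
  by move=> z w /andP[xz _] /andP[zw ->]; rewrite (le_trans xz zw).
rewrite (bigD1 x) ?lexx //= [X in _ + X]big1 ?addr0 => [|w /andP[/andP[xw wy] wx]].
  rewrite (big_pred1 x) ?mobiusE ?eqxx ?mul1r // => z; rewrite /= -andbA.
  apply/and4P/eqP => [[xz zy zx _]|->]; last by rewrite lexx xy.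
  by apply/le_anti; rewrite xz zx.
rewrite -mulr_suml (eq_bigl (fun z => (x <= z <= w)%O)) => [|z].
  by rewrite sum_mobius // eq_sym (negPf wx) mul0r.
rewrite wy andbT; apply/andP/andP => [[/andP[-> _] ->]|[-> zw]] //.
by rewrite zw (le_trans zw wy).
Qed.

Lemma mobius_inversion_down (F G : P -> int) y :
  (forall z, (z <= y)%O -> G z = \sum_(w | (w <= z)%O) F w) ->
  F y = \sum_(z | (z <= y)%O) mobius z y * G z.
Proof.
move=> GF; under eq_bigr => z zy do rewrite GF // mulr_sumr.
rewrite (exchange_big_dep (fun w => (w <= y)%O)) /=; last first.
  by move=> z w zy wz; apply: le_trans wz zy.
rewrite (bigD1 y) ?lexx //= [X in _ + X]big1 ?addr0 => [|w /andP[wy nwy]].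
  rewrite (big_pred1 y) ?mobiusE ?eqxx ?mul1r // => z /=.
  by apply/andP/eqP => [[zy yz]|->]; [apply/le_anti; rewrite zy | rewrite lexx].
rewrite -mulr_suml (eq_bigl (fun z => (w <= z <= y)%O)) => [|z].
  by rewrite sum_mobius_dual // (negPf nwy) mul0r.
by rewrite andbC.
Qed.

End MobiusInversion.

(** * Counting cells of a left regular band *)

Section BandCounting.
Variable B : lrbType.
Implicit Types (a b c x l : B) (X Y Z W : Lambda B).
Local Open Scope ring_scope.

Definition support b : Lambda B := Sub (lideal b) (imset_f (@lideal B) (isT : b \in B)).

Lemma support_surj X : exists b, support b = X.
Proof. by have /imsetP[b _ Xb] := valP X; exists b; apply: val_inj. Qed.

Lemma in_L X b : (b \in L X) = (support b == X).
Proof. by rewrite inE -val_eqE. Qed.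

Lemma in_B_ge X b : (b \in B_ge X) = (X <= support b)%O.
Proof. by rewrite inE. Qed.

Lemma support_leE a b : (support a <= support b)%O = ((a * b)%g == a).
Proof. exact: lideal_sub. Qed.

Lemma band_leE a b : (a <= b)%O = ((b * a)%g == a).
Proof. by []. Qed.

Lemma le_support a b : (a <= b)%O -> (support a <= support b)%O.
Proof.
rewrite band_leE support_leE => /eqP ba.
by rewrite -ba lrb_mulxyx.
Qed.

Lemma mul_le a b : ((a * b)%g <= a)%O.
Proof. by rewrite band_leE mulgA lrb_mulxx. Qed.

Lemma support_mul a b : (support b <= support a)%O -> support (a * b)%g = support b.
Proof.
by move=> /setIidPr ab; apply: val_inj; rewrite /= lideal_mul.
Qed.

(** Elements of equal support form an antichain, whence [b] is minimal in [B_ge (support b)]. *)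
Lemma support_min a b : (a <= b)%O -> support a = support b -> a = b.
Proof.
move=> /eqP ba sab; have : (b * a)%g == b by rewrite -support_leE sab lexx.
by rewrite ba => /eqP.
Qed.

Variable (R : realType).
Hypothesis B_cw : cw_lrb B R.

Lemma euler_down_lt Y b : b \in B_ge Y ->
  euler (order_complex (down_lt (B_ge Y) b)) = (-1) ^+ rank (B_ge Y) b.
Proof.
move=> bY; have [_ /(_ b bY)] := B_cw Y.
apply: euler_sphere; [exact: down_closed_order_complex | exact: set0_order_complex].
Qed.

Lemma rank_support_add Y b x : b \in B_ge Y -> (b <= x)%O ->
  rank (B_ge Y) x = (rank (B_ge Y) b + rank (B_ge (support b)) x)%N.
Proof.
move=> bY bx; rewrite in_B_ge in bY; apply: rank_add => //.
- by have [] := B_cw Y.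
- by have [] := B_cw (support b).
- by apply/subsetP => q; rewrite !in_B_ge; apply: le_trans.
- by rewrite in_B_ge lexx.
- by rewrite in_B_ge le_support.
- by move=> q _ /le_support; rewrite in_B_ge.
- move=> q; rewrite in_B_ge => bq qb; apply: support_min => //.
  by apply/le_anti; rewrite bq le_support.
Qed.

Definition sign x W : int := (-1) ^+ rank (B_ge W) x.

Lemma sign_sqr x W : sign x W * sign x W = 1.
Proof. by rewrite -expr2 sqrr_sign. Qed.

(** This cocycle rule is how additivity of ranks is used: the sign of [x] seen from [W] splits at
    any cell below [x]. *)
Lemma sign_trans x b W : (W <= support b)%O -> (b <= x)%O ->
  sign x W = sign b W * sign x (support b).
Proof.
by move=> Wb bx; rewrite -exprD -rank_support_add // in_B_ge.
Qed.

Definition below x W : {set B} := [set l in L W | (l <= x)%O].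

(** Multiply by [sign x Y] the relation saying that the signs of the cells below [x] sum to 1. By
    the cocycle rule the term of a cell q becomes [sign x W] with W the support of q, so the cells
    can be grouped by support. *)
Lemma sum_below x Y : (Y <= support x)%O ->
  \sum_(W | (Y <= W <= support x)%O) (#|below x W|%:Z * sign x W) = sign x Y.
Proof.
move=> Yx; have xY : x \in B_ge Y by rewrite in_B_ge.
have xA : x \in down_le (B_ge Y) x by rewrite inE xY lexx.
have xmax q : q \in down_le (B_ge Y) x -> (q <= x)%O by rewrite inE => /andP[].
have H : \sum_(q in down_le (B_ge Y) x) sign q Y = 1.
  rewrite -[RHS](sum_euler_down xA xmax).
  apply: eq_bigr => q; rewrite inE => /andP[qY qx]; rewrite /sign -euler_down_lt //.
  congr (euler (order_complex _)); apply/setP => r; rewrite !inE.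
  by case: (boolP (r < q)%O) => rq; rewrite ?andbF // (le_trans (ltW rq) qx) !andbT.
rewrite -[RHS]mulr1 -H mulr_sumr.
rewrite (partition_big support (fun W => (Y <= W <= support x)%O)) /=; last first.
  by move=> q; rewrite inE in_B_ge => /andP[-> /le_support].
apply: eq_bigr => W /andP[YW Wx].
rewrite (eq_bigr (fun _ => sign x W)) => [|q /andP[qA /eqP qW]]; last first.
  move: qA; rewrite inE in_B_ge => /andP[Yq qx].
  by rewrite (sign_trans Yq qx) qW mulrAC sign_sqr mul1r.
rewrite sumr_const -mulr_natl; congr (_ * _).
rewrite natz; congr (Posz _); apply: eq_card => q.
rewrite [RHS]unfold_in /= inE in_L inE in_B_ge andbC [RHS]andbC.
by case: eqP => [->|_]; rewrite ?andbF // YW andbT.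
Qed.

Lemma card_below x Y : (Y <= support x)%O ->
  #|below x Y|%:Z = sign x Y * \sum_(W | (Y <= W <= support x)%O) mobius Y W * sign x W.
Proof.
move=> Yx.
have := @mobius_inversion_up _ _ (fun W => #|below x W|%:Z * sign x W) (sign x) Y (support x).
move=> <- //; first by rewrite mulrCA sign_sqr mulr1.
by move=> Z /andP[_ Zx]; rewrite sum_below.
Qed.

(** The module theory enters only through the rank equations for [m], one for each support; they are
    triangular and determine [m]. *)
Lemma sum_mobius_below (m : Lambda B -> nat) Y X :
  (forall b, \sum_(W | (W <= support b)%O) m W = #|below b Y|)%N ->
  m X = if (Y <= X)%O then absz (mobius Y X) else 0%N.
Proof.
move=> mP; have [x xX] := support_surj X.
(* Multiplying [x] by any element of support [Z] gives a representative below [x], so that all the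
   signs can be compared with those of [x]. *)
have rep Z : exists b, (Z <= X)%O -> (b <= x)%O /\ support b = Z.
  have [l lZ] := support_surj Z; exists (x * l)%g => ZX; split; first exact: mul_le.
  by rewrite support_mul lZ // xX.
have {rep} /choice[b bP] := rep.
have mE : (m X)%:Z = \sum_(Z | (Z <= X)%O) mobius Z X * #|below (b Z) Y|%:Z.
  apply: (@mobius_inversion_down _ _ (fun W => (m W)%:Z)) => Z ZX.
  by rewrite -mP (bP Z ZX).2 -natz natr_sum; apply: eq_bigr => W _; rewrite natz.
case: ifP => [YX|nYX]; last first.
  apply/eqP; rewrite -(eqr_nat int) natz mE big1 // => Z ZX.
  rewrite (_ : below _ _ = set0) ?cards0 ?mulr0 //.
  apply/setP => l; rewrite in_set0 inE in_L; apply/negP => /andP[/eqP lY /le_support].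
  by rewrite lY (bP Z ZX).2 => /le_trans/(_ ZX); rewrite nYX.
(* Passing from [b Z] to [x] introduces [sign x Z] twice, and it cancels: [Z] then occurs only in
   the range of the sum. *)
have cE Z : (Y <= Z <= X)%O -> #|below (b Z) Y|%:Z =
    sign x Y * \sum_(W | (Y <= W <= Z)%O) mobius Y W * sign x W.
  case/andP=> YZ ZX; have [bx bZ] := bP Z ZX.
  have sE W : (W <= Z)%O -> sign x W = sign (b Z) W * sign x Z.
    by move=> WZ; rewrite (sign_trans _ bx) bZ.
  rewrite card_below bZ // (sE Y) // -[RHS]mulrA; congr (_ * _); rewrite mulr_sumr.
  apply: eq_bigr => W /andP[YW WZ]; rewrite (sE W) //.
  by rewrite [RHS]mulrC -!mulrA sign_sqr mulr1.
have mE' : (m X)%:Z = sign x Y * (mobius Y X * sign x X).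
  rewrite mE (bigID (fun Z => (Y <= Z)%O)) /= [X in _ + X]big1 ?addr0; last first.
    move=> Z /andP[ZX nYZ]; rewrite (_ : below _ _ = set0) ?cards0 ?mulr0 //.
    apply/setP => l; rewrite in_set0 inE in_L; apply/negP => /andP[/eqP lY /le_support].
    by rewrite lY (bP Z ZX).2 (negPf nYZ).
  rewrite (eq_bigr (fun Z => sign x Y * (mobius Z X *
      \sum_(W | (Y <= W <= Z)%O) mobius Y W * sign x W))); last first.
    by move=> Z /andP[ZX YZ]; rewrite cE ?YZ // mulrCA.
  rewrite -mulr_sumr; congr (_ * _).
  (* Extension by zero off the elements above [Y] lets the second inversion run over the whole ideal
     below [X]; it returns [F X]. *)
  pose F W := if (Y <= W)%O then mobius Y W * sign x W else 0.
  pose G Z := \sum_(W | (Y <= W <= Z)%O) mobius Y W * sign x W.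
  have -> : mobius Y X * sign x X = F X by rewrite /F YX.
  rewrite (@mobius_inversion_down _ _ F G X); last first.
    by move=> Z _; rewrite -big_mkcondl.
  rewrite [RHS](bigID (fun Z => (Y <= Z)%O)) /= [X in _ = _ + X]big1 ?addr0 //.
  move=> Z /andP[_ nYZ]; rewrite /G big_pred0 ?mulr0 // => W.
  by apply/negP => /andP[/le_trans YW /YW]; rewrite (negPf nYZ).
have := congr1 absz mE'; rewrite absz_nat => ->.
by rewrite !abszM !abszX !exp1n mul1n muln1.
Qed.

End BandCounting.

(** * Composition factors *)

Section BandModules.
Variables (k : fieldType) (B : lrbType) (M : sgmodule k B).
Implicit Types (a b c : B) (X Y : Lambda B) (U V W : {vspace M}) (u v : M).

Definition delta b : sgalg k B := [ffun c => (c == b)%:R].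

Definition act b : 'End(M) := sgact M (delta b).

Lemma sgalg_mul_delta a b : sgalg_mul (delta a) (delta b) = delta (a * b)%g.
Proof.
apply/ffunP => c; rewrite !ffunE.
rewrite (eq_bigr (fun ab : B * B => (ab == (a, b))%:R)) => [|[a' b'] _]; last first.
  by rewrite !ffunE xpair_eqE -natrM mulnb.
case: (c =P (a * b)%g) => [->|ne].
  rewrite (bigD1 (a, b)) //= eqxx big1 ?addr0 // => ab /andP[_ /negPf->].
  by [].
by rewrite big1 // => -[a' b'] /= /eqP abc; case: eqP => // -[ea eb]; case: ne; rewrite -abc ea eb.
Qed.

Lemma actM a b u : act (a * b)%g u = act a (act b u).
Proof. by rewrite /act -sgalg_mul_delta sgactM comp_lfunE. Qed.

Lemma sgalg_sum (f : sgalg k B) : f = \sum_b f b *: delta b.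
Proof.
apply/ffunP => c; rewrite sum_ffunE (bigD1 c) //= big1 => [|b bc].
  by rewrite !ffunE eqxx addr0 /GRing.scale /= mulr1.
by rewrite !ffunE eq_sym (negPf bc) scaler0.
Qed.

Lemma sgactE (f : sgalg k B) u : sgact M f u = \sum_b f b *: act b u.
Proof.
rewrite {1}[f]sgalg_sum linear_sum sum_lfunE; apply: eq_bigr => b _.
by rewrite linearZ scale_lfunE.
Qed.

Lemma submoduleP U : submodule U <-> forall b u, u \in U -> act b u \in U.
Proof.
split=> [sU b u uU|sU f].
  by apply: (subvP (sU (delta b))); apply: memv_img.
apply/subvP => _ /memv_imgP[u uU ->]; rewrite sgactE.
by apply: memv_suml => b _; apply: memvZ; apply: sU.
Qed.

Definition acts_id U W b := forall u, u \in U -> act b u - u \in W.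
Definition acts_0 U W b := forall u, u \in U -> act b u \in W.

(* As bab = ba, the kernel of b on a module is a submodule. *)
Lemma simple_quotient_act U W b : simple_quotient U W -> acts_0 U W b \/ acts_id U W b.
Proof.
move=> [/submoduleP sU /submoduleP sW WU _ smax].
pose N := (U :&: (act b @^-1: W))%VS.
have NP u : (u \in N) = (u \in U) && (act b u \in W).
  by rewrite memv_cap -memv_preim.
have [||N_W|N_U] := smax N.
- apply/submoduleP => a u; rewrite !NP => /andP[uU buW].
  by rewrite sU //= -actM -lrb_mulxyx actM; apply: sW.
- rewrite capvSl andbT; apply/subvP => w wW.
  by rewrite NP (subvP WU) // sW.
(* Since [b] is idempotent it kills [b u - u], which therefore lies in [N], here equal to [W]. *)
- right=> u uU; rewrite -N_W NP rpredB ?sU //=.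
  by rewrite linearB /= -actM lrb_mulxx subrr mem0v.
- by left=> u; rewrite -N_U NP => /andP[].
Qed.

Lemma simple_quotient_witness U W : simple_quotient U W ->
  exists2 v, v \in U & v \notin W.
Proof.
move=> [_ _ WU nWU _]; apply/not_exists2P => H.
move/eqP: nWU; case; apply/eqP; rewrite eqEsubv WU; apply/subvP => v vU.
by have [] := H v => // /negP; rewrite negbK.
Qed.

Lemma simple_quotient_line U W v : simple_quotient U W -> v \in U -> v \notin W ->
  U = (W + <[v]>)%VS.
Proof.
move=> sUW vU vW; have [/submoduleP sU /submoduleP sW WU _ smax] := sUW.
have [||VW|//] := smax (W + <[v]>)%VS.
- apply/submoduleP => b _ /memv_addP[w wW [_ /vlineP[c ->] ->]].
  rewrite linearD linearZ /=; case: (simple_quotient_act b sUW) => h.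
    by apply: (subvP (addvSl _ _)); rewrite rpredD ?sW // rpredZ // h.
  rewrite -[act b v](subrK v) scalerDr addrA; apply: memv_add.
    by rewrite rpredD ?sW // rpredZ // h.
  by rewrite rpredZ // memv_line.
- by rewrite addvSl subv_add WU -memvE.
- by case/negP: vW; rewrite -VW memvE addvSr.
Qed.

Lemma simple_quotient_dim U W : simple_quotient U W -> \dim U = (\dim W).+1.
Proof.
move=> sUW; have [v vU vW] := simple_quotient_witness sUW.
rewrite (simple_quotient_line sUW vU vW) addvC dimv_disjoint_sum.
  rewrite dim_vline; case: (v =P 0) vW => [->|_ _]; last by rewrite /= add1n.
  by rewrite mem0v.
apply/eqP; rewrite -subv0; apply/subvP => u; rewrite memv_cap => /andP[/vlineP[c ->]].
have [->|c0] := eqVneq c 0; first by rewrite scale0r !mem0v.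
by move=> cvW; case/negP: vW; rewrite -(scalerK c0 v) rpredZ.
Qed.

Lemma acts_id_0 U W b : simple_quotient U W -> acts_id U W b -> acts_0 U W b -> False.
Proof.
move=> sUW h1 h0; have [v vU] := simple_quotient_witness sUW.
by rewrite -[v](subKr (act b v)) rpredB ?h0 ?h1.
Qed.

Lemma separating_functional W v : v \notin W -> exists h : 'Hom(M, k^o),
  h v != 0 /\ forall w, w \in W -> h w = 0.
Proof.
move=> vW; pose p := daddv_pi (W^C)%VS W.
have splitE w : daddv_pi W (W^C)%VS w + p w = w.
  by apply: daddv_pi_add; rewrite ?capv_compl // addv_complf memvf.
have pW w : w \in W -> p w = 0.
  move=> wW; have := splitE w; rewrite daddv_pi_id ?capv_compl // => /eqP.
  by rewrite -subr_eq0 addrC addKr => /eqP.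
have pv : p v != 0.
  apply: contraNneq vW => pv0; rewrite -[v]splitE pv0 addr0; exact: memv_pi.
have [i vi] : exists i, coord (vbasis {:M}) i (p v) != 0.
  apply/existsP; apply: contraNT pv; rewrite negb_exists => /forallP c0.
  rewrite [p v](coord_vbasis (memvf _)) big1 // => i _.
  by have := c0 i; rewrite negbK => /eqP ->; rewrite scale0r.
have flin : linear (fun w => coord (vbasis {:M}) i (p w) : k^o).
  by move=> c w1 w2; rewrite !linearP.
pose f : {linear M -> k^o} := HB.pack (fun w => coord (vbasis {:M}) i (p w) : k^o)
  (GRing.isLinear.Build k M k^o _ _ flin).
exists (linfun f); split=> [|w wW]; rewrite lfunE //=.
by rewrite pW // linear0.
Qed.

(** A simple quotient is a line, so the values 0 or 1 by which the elements of [B] act determine it.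
    The isomorphism is a linear form vanishing on [W] but not on [U]. *)
Lemma quotient_iso_simple U W X : simple_quotient U W ->
  quotient_iso U W (simple_module k X) <->
  forall b, if supports b X then acts_id U W b else acts_0 U W b.
Proof.
move=> sUW; have [/submoduleP sU /submoduleP sW WU _ _] := sUW.
have simpleE b (r : k^o) : sgact (simple_module k X) (delta b) r =
    if supports b X then r else 0.
  rewrite /= /linext sum_lfunE (bigD1 b) //= big1 ?addr0 => [|c cb].
    rewrite scale_lfunE ffunE eqxx scale1r /simple_act.
    by case: ifP => _; rewrite ?id_lfunE ?zero_lfunE.
  by rewrite scale_lfunE ffunE (negPf cb) scale0r.
split=> [[h [_ hker hact]] b|Xact].
  have inW u : u \in U -> h u = 0 -> u \in W.
    by move=> uU hu; rewrite -hker memv_cap uU memv_ker hu eqxx.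
  case: ifP => bX u uU; apply: inW.
  - by rewrite rpredB // sU.
  - by rewrite linearB /= [h (act b u)]hact // simpleE bX subrr.
  - exact: sU.
  - by rewrite [h (act b u)]hact // simpleE bX.
have [v vU vW] := simple_quotient_witness sUW.
have [h [hv hW]] := separating_functional vW.
have UE := simple_quotient_line sUW vU vW.
exists h; split.
- apply/eqP; rewrite eqEsubv subvf; apply/subvP => r _.
  have -> : r = h (((r : k) / h v) *: v) by rewrite linearZ; apply/esym; exact: divfK.
  by rewrite memv_img // memvZ.
- apply/eqP; rewrite eqEsubv; apply/andP; split; apply/subvP => u.
    rewrite memv_cap UE memv_ker => /andP[/memv_addP[w wW [_ /vlineP[c ->] ->]]].
    rewrite linearD linearZ /= hW // add0r mulf_eq0 (negPf hv) orbF => /eqP ->.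
    by rewrite scale0r addr0.
  by move=> uW; rewrite memv_cap (subvP WU) // memv_ker hW // eqxx.
- move=> f u uU; rewrite sgactE linear_sum [sgact _ f]/= /linext sum_lfunE.
  apply: eq_bigr => b _; rewrite linearZ /= scale_lfunE; congr (_ *: _).
  have := Xact b; rewrite /simple_act; case: ifP => bX hb.
    rewrite id_lfunE; apply/eqP; rewrite -subr_eq0 -linearB /=; apply/eqP/hW.
    exact: hb.
  by rewrite zero_lfunE hW // hb.
Qed.

(** If [b] kills the quotient then b U = b (b U) lies in b W. If it acts as the identity, its kernel
    on [U] already lies in [W], and rank-nullity gives exactly one more dimension. *)
Lemma act_rank_step U W b : simple_quotient U W ->
  \dim (act b @: U) = (\dim (act b @: W) + `[< acts_id U W b >])%N.
Proof.
move=> sUW; have [/submoduleP sU /submoduleP sW WU _ _] := sUW.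
have [h0|h1] := simple_quotient_act b sUW.
  rewrite asboolF ?addn0; last by move=> h1; apply: acts_id_0 sUW h1 h0.
  congr (\dim _); apply/eqP; rewrite eqEsubv; apply/andP; split; last exact: limgS.
  apply/subvP => _ /memv_imgP[u uU ->].
  by rewrite -{1}(lrb_mulxx b) actM memv_img // h0.
rewrite asboolT //.
have := limg_ker_dim (act b) U; have := limg_ker_dim (act b) W.
rewrite (simple_quotient_dim sUW) => <-.
have -> : (U :&: lker (act b) = W :&: lker (act b))%VS.
  apply/eqP; rewrite eqEsubv; apply/andP; split; last exact: capvS.
  rewrite subv_cap capvSr andbT.
  apply/subvP => u; rewrite memv_cap memv_ker => /andP[uU /eqP bu].
  by have := h1 u uU; rewrite bu sub0r rpredN.
by rewrite -addnS => /addnI ->; rewrite addn1.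
Qed.

Lemma composition_rank n (F : nat -> {vspace M}) b : composition_series n F ->
  \dim (limg (act b)) = (\sum_(i < n) `[< acts_id (F i.+1) (F i) b >])%N.
Proof.
move=> [F0 Fn Fs].
have rankF m : (m <= n)%N ->
    \dim (act b @: F m) = (\sum_(i < m) `[< acts_id (F i.+1) (F i) b >])%N.
  elim: m => [_|m IHm mn]; first by rewrite F0 limg0 dimv0 big_ord0.
  by rewrite big_ord_recr /= -(IHm (ltnW mn)) (act_rank_step _ (Fs m mn)).
by rewrite -rankF // Fn.
Qed.

(* The elements acting as the identity are those supporting X, where X is the
   support of one of them with the smallest possible left ideal. *)
Lemma acts_id_supports U W b : simple_quotient U W -> acts_id U W b ->
  exists X, forall c, acts_id U W c <-> supports c X.
Proof.
move=> sUW bid; have [/submoduleP sU /submoduleP sW WU _ _] := sUW.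
have idM a c : acts_id U W (a * c)%g <-> acts_id U W a /\ acts_id U W c.
  split=> [h|[ha hc] u uU].
    have [ha|ha] := simple_quotient_act a sUW.
      by case: (acts_id_0 sUW h) => u uU; rewrite actM ha // sU.
    split=> //; have [hc|//] := simple_quotient_act c sUW.
    by case: (acts_id_0 sUW h) => u uU; rewrite actM sW // hc.
  by rewrite actM -[_ - u](subrKA (act c u)) rpredD ?ha ?hc // sU.
pose I := [pred c | `[< acts_id U W c >]].
have Ib : I b by apply/asboolP.
case: (arg_minnP (fun c : B => #|lideal c|) Ib) => m /asboolP mid mmin.
exists (support m) => c; rewrite /supports; split=> [cid|/=].
  have /mmin : I (m * c)%g by apply/asboolP/idM.
  rewrite lideal_mul => card_m.
  have /setIidPl // : lideal m :&: lideal c = lideal m.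
  by apply/eqP; rewrite eqEcard subsetIl.
rewrite lideal_sub => /eqP mc.
by have [_] : acts_id U W m /\ acts_id U W c by apply/idM; rewrite mc.
Qed.

(** The set of elements acting as the identity determines [X], so at most one term of the sum is
    nonzero; its [X] lies below the support of [b] exactly when [b] belongs to that set. *)
Lemma quotient_iso_count U W b : simple_quotient U W ->
  (\sum_(X | (X <= support b)%O) `[< quotient_iso U W (simple_module k X) >])%N =
  `[< acts_id U W b >].
Proof.
move=> sUW; case: asboolP => [bid|nbid].
  have [X0 X0P] := acts_id_supports sUW bid.
  have isoP X : quotient_iso U W (simple_module k X) <-> X = X0.
    rewrite quotient_iso_simple //; split=> [XP|-> c].
      have XX0 c : supports c X = supports c X0.
        apply/idP/idP => cX.
          by apply/X0P; have := XP c; rewrite cX.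
        apply/negPn/negP => ncX; have := XP c; rewrite (negPf ncX).
        by apply: acts_id_0 => //; apply/X0P.
      have [x xX] := support_surj X; have [y yX0] := support_surj X0.
      apply/le_anti/andP; split.
        have : supports y X0 by rewrite /supports -yX0 /=.
        by rewrite -XX0 -yX0.
      have : supports x X by rewrite /supports -xX /=.
      by rewrite XX0 -xX.
    case: ifP => cX; first exact/X0P.
    have [//|/X0P] := simple_quotient_act c sUW.
    by rewrite cX.
  rewrite (bigD1 X0) /=; last exact/X0P.
  rewrite asboolT ?isoP // big1 // => X /andP[_ /eqP XX0].
  by rewrite asboolF // isoP.
rewrite big1 // => X Xb; rewrite asboolF // => /(quotient_iso_simple _ sUW)/(_ b).
by have -> : supports b X := Xb.
Qed.

Lemma factor_count_rank n (F : nat -> {vspace M}) b : composition_series n F ->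
  (\sum_(X | (X <= support b)%O) factor_count n F (simple_module k X))%N =
  \dim (limg (act b)).
Proof.
move=> cF; rewrite (composition_rank _ cF) /factor_count exchange_big.
by apply: eq_bigr => i _; apply: quotient_iso_count; have [_ _] := cF; apply.
Qed.

Lemma exists_simple_quotient W : submodule W -> W != fullv ->
  exists U, simple_quotient U W.
Proof.
move=> sW nW.
pose Q d := `[< exists U, [/\ submodule U, (W <= U)%VS, W != U & \dim U = d] >].
have [|d /asboolP[U [sU WU WnU dU]] dmin] := @ex_minnP Q.
  exists (\dim {:M}); apply/asboolP; exists fullv; split=> //; last exact: subvf.
  by apply/submoduleP => b u _; apply: memvf.
exists U; split=> // V sV /andP[WV VU].
have [->|WnV] := eqVneq W V; [by left|right].
apply/eqP; rewrite eqEdim VU dU; apply: dmin.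
by apply/asboolP; exists V.
Qed.

Lemma composition_series_exists :
  exists n (F : nat -> {vspace M}), composition_series n F.
Proof.
suff H m W : submodule W -> (\dim {:M} - \dim W < m)%N -> exists n F,
    [/\ F 0%N = W, F n = fullv &
      forall i, (i < n)%N -> simple_quotient (F i.+1) (F i)].
  apply: (H _ 0%VS _ (ltnSn _)); apply/submoduleP => b u.
  by rewrite memv0 => /eqP ->; rewrite linear0 mem0v.
elim: m W => // m IHm W sW; rewrite ltnS => dWm.
have [->|nW] := eqVneq W fullv; first by exists 0%N, (fun=> fullv); split.
have [U sUW] := exists_simple_quotient sW nW.
have [sU _ _ _ _] := sUW; have dU := simple_quotient_dim sUW.
have [|n [F [F0 Fn Fs]]] := IHm U sU.
  apply: leq_trans dWm; rewrite dU subnS prednK // subn_gt0.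
  by rewrite -dU dimvS // subvf.
exists n.+1, (fun i => if i is i'.+1 then F i' else W); split=> // -[|i] /= ilt.
  by rewrite F0.
exact: Fs.
Qed.

End BandModules.

(** * Ranks on the projective modules *)

(** When [b] supports [Y] it acts on the basis [L Y] as an idempotent map, whose image is the set of
    basis elements l with b l = l, that is l below [b]. The image of the operator is then the space
    of functions on that set, extended by zero. Otherwise [b] acts as 0 and nothing of [L Y] lies
    below it. *)
Lemma dim_kL_act (k : fieldType) (B : lrbType) (Y : Lambda B) (b : B) :
  \dim (limg (kL_act k Y b)) = #|below b Y|.
Proof.
have [bY|bY] := boolP (supports b Y); last first.
  rewrite (_ : kL_act k Y b = 0) ?lim0g ?dimv0.
    apply/esym/eqP; rewrite cards_eq0; apply/eqP/setP => l.
    rewrite in_set0 inE in_L; apply/negP => /andP[/eqP lY /le_support].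
    by rewrite lY; apply/negP.
  apply/lfunP => v; rewrite lfunE zero_lfunE /=; apply/ffunP => m.
  by rewrite !ffunE (negPf bY).
pose S := {l : B | l \in below b Y}.
have SL (l : S) : val l \in L Y by have := valP l; rewrite inE => /andP[].
have Sb (l : S) : (b * val l)%g = val l.
  by have := valP l; rewrite inE => /andP[_]; rewrite band_leE => /eqP.
pose E := {ffun S -> k^o}.
pose incl (v : E) : kL k Y := [ffun m => if insub (val m) is Some l then v l else 0].
have incl_lin : linear incl.
  move=> c u v; apply/ffunP => m; rewrite !ffunE.
  by case: insub => [l|]; rewrite ?ffunE // scaler0 addr0.
pose i : {linear E -> kL k Y} := HB.pack incl (GRing.isLinear.Build k E (kL k Y) _ _ incl_lin).
have iE (v : E) (l : S) : i v (Sub (val l) (SL l)) = v l.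
  by rewrite /= ffunE /= valK.
have i_inj : lker (linfun i) == 0%VS.
  apply/lker0P => u v; rewrite !lfunE => uv; apply/ffunP => l.
  by rewrite -!iE uv.
have -> : limg (kL_act k Y b) = limg (linfun i).
  apply/eqP; rewrite eqEsubv; apply/andP; split; apply/subvP => _ /memv_imgP[v _ ->].
    rewrite lfunE /=.
    pose w : E := [ffun l => kL_fun b v (Sub (val l) (SL l))].
    suff -> : kL_fun b v = linfun i w by apply: memv_img; apply: memvf.
    rewrite lfunE; apply/ffunP => m; rewrite [RHS]ffunE.
    case: insubP => [l _ lm|nm].
      by rewrite [RHS]ffunE; congr (fun_of_fin _ _); apply: val_inj.
    rewrite ffunE bY big_pred0 // => l; apply/negP => /eqP blm.
    case/negP: nm; rewrite inE (valP m) band_leE -blm mulgA lrb_mulxx.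
    by rewrite eqxx.
  rewrite lfunE /=.
  suff -> : incl v = kL_act k Y b (incl v) by apply: memv_img; apply: memvf.
  rewrite lfunE /=; apply/ffunP => m; rewrite [RHS]ffunE bY.
  have [bm|nbm] := boolP (val m \in below b Y); last first.
    rewrite ffunE insubF ?(negPf nbm) //; apply/esym.
    rewrite big1 // => l blm; rewrite ffunE; case: insubP => [l' _ l'l|//].
    by case/negP: nbm; rewrite -(eqP blm) -l'l Sb (valP l').
  rewrite (bigD1 m) /=; last first.
    by move: bm; rewrite inE => /andP[_]; rewrite band_leE.
  rewrite big1 ?addr0 // => l /andP[/eqP blm lm]; rewrite ffunE.
  case: insubP => [l' _ l'l|//]; case/eqP: lm; apply: val_inj.
  by rewrite -[LHS]l'l -Sb l'l.
rewrite limg_dim_eq; last by rewrite (eqP i_inj) capv0.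
by rewrite dimvf /dim /= muln1 card_sig.
Qed.

Lemma act_projective (k : fieldType) (B : lrbType) (Y : Lambda B) (b : B) :
  act (projective_module k Y) b = kL_act k Y b.
Proof.
rewrite /act /= /linext (bigD1 b) //= big1 ?addr0 => [|c cb].
  by rewrite ffunE eqxx scale1r.
by rewrite ffunE (negPf cb) scale0r.
Qed.

(* Lambda B is ordered by inclusion, so (Y <= X)%O means X >= Y. *)
Theorem theorem9p7 (R : realType) (k : fieldType) (B : lrbType)
    (B_connected : connected_lrb B R) (B_cw : cw_lrb B R) :
  cartan_matrix k
    (fun X Y : Lambda B => if (Y <= X)%O then absz (mobius Y X) else 0%N).
Proof.
move=> X Y; split=> [|n F cF]; first exact: composition_series_exists.
pose m Z := factor_count n F (simple_module k Z).
apply: (sum_mobius_below B_cw (m := m)) => b.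
by rewrite (factor_count_rank _ cF) act_projective dim_kL_act.
Qed.
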